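(* Let $\mathcal{G}_1$ and $\mathcal{G}_2$ be two isomorphic, asymmetric and friendly weighted undirected graphs with adjacency matrices $\mathbf{A}$ and $\mathbf{B}$, and let $\mathbf{\Pi}^*$ be the unique permutation matrix with $\mathbf{A}=(\mathbf{\Pi}^{*})^\top\mathbf{B}\mathbf{\Pi}^*$. Let the interaction graph $\mathcal{H}$ be undirected and connected. Then every trajectory $\mathbf{Q}(t)$ of the system (D) given in the context, with an initial condition $\mathbf{Q}(0)$ such that $\mathbf{P}_i(0)\in\mathcal{D}_n$ for all $i$ (and all other components of $\mathbf{Q}(0)$ arbitrary), converges globally exponentially to an equilibrium of (D): there are constants $c,\alpha>0$ such that for each such trajectory there is an equilibrium $\bar{\mathbf{Q}}$ of (D) with $\|\mathbf{Q}(t)-\bar{\mathbf{Q}}\|_F\le c\,e^{-\alpha t}\|\mathbf{Q}(0)-\bar{\mathbf{Q}}\|_F$ for all $t\ge 0$. In addition, $\mathbf{P}_i(t)\to\mathbf{\Pi}^*$ exponentially fast as $t\to\infty$, for all $i=1,\dots,n$.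
   Context: Graphs. $\mathcal{G}_1,\mathcal{G}_2$ are undirected weighted graphs on the vertex set $\{1,\dots,n\}$ with symmetric adjacency matrices $\mathbf{A},\mathbf{B}\in[0,\infty)^{n\times n}$; $\mathbf{a}_i,\mathbf{b}_i\in\mathbb{R}^n$ are the $i$th columns of $\mathbf{A},\mathbf{B}$. $\mathcal{P}$ is the set of $n\times n$ permutation matrices. $\mathcal{G}_1,\mathcal{G}_2$ are isomorphic if $\mathbf{A}=\mathbf{\Pi}^\top\mathbf{B}\mathbf{\Pi}$ for some $\mathbf{\Pi}\in\mathcal{P}$. A graph with adjacency matrix $\mathbf{A}$ is asymmetric if the only $\mathbf{\Pi}\in\mathcal{P}$ with $\mathbf{A}=\mathbf{\Pi}^\top\mathbf{A}\mathbf{\Pi}$ is the identity; two isomorphic asymmetric graphs are related by a unique permutation matrix. A graph is friendly if its adjacency matrix has $n$ distinct eigenvalues and none of its eigenvectors is orthogonal to $\mathbf{1}_n$ (the all-ones vector). Projection. $\mathcal{D}_n=\{\mathbf{P}\in\mathbb{R}^{n\times n}:\mathbf{P}\mathbf{1}_n=\mathbf{1}_n\}$, and $\mathrm{Proj}_{\mathcal{D}_n}(\mathbf{V}):=\mathbf{V}(\mathbf{I}_n-\frac1n\mathbf{1}_n\mathbf{1}_n^\top)$ for $\mathbf{V}\in\mathbb{R}^{n\times n}$. Agents. There are $n$ agents, with interaction graph $\mathcal{H}$ on $\{1,\dots,n\}$, undirected and connected, with weights $w_{ij}=w_{ji}>0$ if $(i,j)$ is an edge of $\mathcal{H}$ and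 $w_{ij}=w_{ji}=0$ otherwise. Agent $i$ has variables $\mathbf{P}_i,\mathbf{K}_i,\Theta_i,\Upsilon_i\in\mathbb{R}^{n\times n}$ and $\mathbf{y}_i,\mathbf{z}_i,\boldsymbol{\lambda}_i\in\mathbb{R}^n$; $\mathbf{Q}$ denotes the collection of all these variables over $i=1,\dots,n$, and $\|\mathbf{Q}\|_F$ is the square root of the sum of squares of all its entries. $[\mathbf{Y}]_i\in\mathbb{R}^{n\times n}$ is the matrix whose $i$th column is $\mathbf{y}_i$ and whose other columns are zero; $[\mathbf{Z}]^i\in\mathbb{R}^{n\times n}$ is the matrix whose $i$th row is $\mathbf{z}_i^\top$ and whose other rows are zero. $(\mathbf{M})_i^{\mathrm C}$ and $(\mathbf{M})_i^{\mathrm R}$ denote the $i$th column vector and $i$th row vector of $\mathbf{M}$. System (D): for all $i=1,\dots,n$, $$\dot{\mathbf{P}}_i=\mathrm{Proj}_{\mathcal{D}_n}\Big\{-(\mathbf{P}_i\mathbf{a}_i-\mathbf{y}_i)\mathbf{a}_i^\top-\mathbf{b}_i\boldsymbol{\lambda}_i^\top-\sum_{j=1}^nw_{ij}(\Theta_i-\Theta_j)-\sum_{j=1}^nw_{ij}(\mathbf{P}_i-\mathbf{P}_j)-\mathbf{b}_i(\mathbf{b}_i^\top\mathbf{P}_i-\mathbf{z}_i^\top)\Big\},$$ $$\dot{\boldsymbol{\lambda}}_i^\top=\mathbf{b}_i^\top\mathbf{P}_i-\mathbf{z}_i^\top,\qquad \dot{\Theta}_i=\sum_{j=1}^nw_{ij}(\mathbf{P}_i-\mathbf{P}_j),$$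 $$\dot{\Upsilon}_i=[\mathbf{Y}]_i-[\mathbf{Z}]^i-\sum_{j=1}^nw_{ij}(\mathbf{K}_i-\mathbf{K}_j)-\sum_{j=1}^nw_{ij}(\Upsilon_i-\Upsilon_j),$$ $$\dot{\mathbf{y}}_i=(\mathbf{P}_i\mathbf{a}_i-\mathbf{y}_i)-(\Upsilon_i)_i^{\mathrm C},\qquad \dot{\mathbf{z}}_i^\top=\boldsymbol{\lambda}_i^\top+(\Upsilon_i)_i^{\mathrm R}+\mathbf{b}_i^\top\mathbf{P}_i-\mathbf{z}_i^\top,\qquad \dot{\mathbf{K}}_i=\sum_{j=1}^nw_{ij}(\Upsilon_i-\Upsilon_j).$$ *)

(* Defs.v *)
From HB Require Import structures.
From mathcomp Require Import all_boot all_order all_algebra.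
From mathcomp Require Import all_classical all_reals all_analysis.

Set Implicit Arguments.
Unset Strict Implicit.
Unset Printing Implicit Defensive.

Import Order.TTheory GRing.Theory Num.Theory.
Import numFieldNormedType.Exports.

Local Open Scope classical_set_scope.
Local Open Scope ring_scope.

Section Graphs.
Context {R : realType} {n : nat}.
Implicit Types (A B Pi : 'M[R]_n) (H : rel 'I_n).

Definition ones : 'cV[R]_n := const_mx 1.

(* Self-loops (nonzero diagonal entries) are allowed. *)
Definition is_adjacency A : Prop := A^T = A /\ forall i j, 0 <= A i j.

Definition perm_relates Pi A B : Prop :=
  is_perm_mx Pi /\ A = Pi^T *m B *m Pi.

Definition isomorphic A B : Prop := exists Pi, perm_relates Pi A B.

Definition asymmetric A : Prop :=
  forall Pi, perm_relates Pi A A -> Pi = 1%:M.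

Definition is_eigenvector A (v : 'cV[R]_n) : Prop :=
  v != 0 /\ exists a : R, A *m v = a *: v.

(* [eigenvalue] is phrased with row vectors; this is only used for symmetric
   matrices, all of whose eigenvalues are real. *)
Definition friendly A : Prop :=
  (exists s : seq R, [/\ uniq s, size s = n & all (eigenvalue A) s]) /\
  (forall v, is_eigenvector A v -> ones^T *m v != 0).

Definition connected_graph H : Prop := forall i j, connect H i j.

Definition edge_weights H (w : 'M[R]_n) : Prop :=
  w^T = w /\ forall i j, if H i j then 0 < w i j else w i j == 0.

End Graphs.

Section System.
Context {R : realType} {n : nat}.
Implicit Types (A B w : 'M[R]_n) (i : 'I_n).

Definition inD (P : 'M[R]_n) : Prop := P *m ones = ones.

Definition projD (V : 'M[R]_n) : 'M[R]_n :=
  V *m (1%:M - n%:R^-1 *: (ones *m ones^T)).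

Definition col_block i (v : 'cV[R]_n) : 'M[R]_n :=
  \matrix_(p, q) if q == i then v p 0 else 0.

Definition row_block i (v : 'rV[R]_n) : 'M[R]_n :=
  \matrix_(p, q) if p == i then v 0 q else 0.

Record state := State {
  Pv : 'I_n -> 'M[R]_n;
  Kv : 'I_n -> 'M[R]_n;
  Thetav : 'I_n -> 'M[R]_n;
  Upsilonv : 'I_n -> 'M[R]_n;
  yv : 'I_n -> 'cV[R]_n;
  zv : 'I_n -> 'cV[R]_n;
  lambdav : 'I_n -> 'cV[R]_n }.

Definition coupling w (M : 'I_n -> 'M[R]_n) i : 'M[R]_n :=
  \sum_j w i j *: (M i - M j).

Definition vfield A B w (Q : state) : state :=
  let: State P K Th Up y z la := Q in
  let a i := col i A in
  let b i := col i B in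
  let resz i : 'rV[R]_n := (b i)^T *m P i - (z i)^T in
  {| Pv i := projD (- ((P i *m a i - y i) *m (a i)^T)
                    - b i *m (la i)^T
                    - coupling w Th i
                    - coupling w P i
                    - b i *m resz i);
     Kv i := coupling w Up i;
     Thetav i := coupling w P i;
     Upsilonv i := col_block i (y i) - row_block i (z i)^T
                   - coupling w K i - coupling w Up i;
     yv i := (P i *m a i - y i) - col i (Up i);
     zv i := ((la i)^T + row i (Up i) + resz i)^T;
     lambdav i := (resz i)^T |}.

Definition zero_state : state :=
  State (fun=> 0) (fun=> 0) (fun=> 0) (fun=> 0) (fun=> 0) (fun=> 0) (fun=> 0).

Definition is_equilibrium A B w (Q : state) : Prop :=
  vfield A B w Q = zero_state.

Definition sqnormF {m k} (M : 'M[R]_(m, k)) : R := \sum_i \sum_j M i j ^+ 2.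

Definition normF {m k} (M : 'M[R]_(m, k)) : R := Num.sqrt (sqnormF M).

Definition sub_state (Q Q' : state) : state :=
  {| Pv i := Pv Q i - Pv Q' i;
     Kv i := Kv Q i - Kv Q' i;
     Thetav i := Thetav Q i - Thetav Q' i;
     Upsilonv i := Upsilonv Q i - Upsilonv Q' i;
     yv i := yv Q i - yv Q' i;
     zv i := zv Q i - zv Q' i;
     lambdav i := lambdav Q i - lambdav Q' i |}.

Definition state_normF (Q : state) : R :=
  Num.sqrt (\sum_i (sqnormF (Pv Q i) + sqnormF (Kv Q i) +
                    sqnormF (Thetav Q i) + sqnormF (Upsilonv Q i) +
                    sqnormF (yv Q i) + sqnormF (zv Q i) +
                    sqnormF (lambdav Q i))).

(* Solution of X' = V on [0, +oo[: continuity up to t = 0 together with the ODE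
   for t > 0; nothing is asked of X at negative times. *)
Definition has_velocity {m k} (X V : R -> 'M[R]_(m, k)) : Prop :=
  {within `[0, +oo[%classic, continuous X} /\
  forall t : R, 0 < t -> is_derive t (1 : R) X (V t).

Definition is_trajectory A B w (Q : R -> state) : Prop :=
  forall i,
    let F t := vfield A B w (Q t) in
    has_velocity (fun t => Pv (Q t) i) (fun t => Pv (F t) i) /\
    has_velocity (fun t => Kv (Q t) i) (fun t => Kv (F t) i) /\
    has_velocity (fun t => Thetav (Q t) i) (fun t => Thetav (F t) i) /\
    has_velocity (fun t => Upsilonv (Q t) i) (fun t => Upsilonv (F t) i) /\
    has_velocity (fun t => yv (Q t) i) (fun t => yv (F t) i) /\
    has_velocity (fun t => zv (Q t) i) (fun t => zv (F t) i) /\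
    has_velocity (fun t => lambdav (Q t) i) (fun t => lambdav (F t) i).

Definition cvg_exponentially {m k} (X : R -> 'M[R]_(m, k)) L : Prop :=
  exists c alpha : R, 0 < c /\ 0 < alpha /\
    forall t : R, 0 <= t -> normF (X t - L) <= c * expR (- alpha * t).

End System.

Arguments state : clear implicits.

(* Main.v *)
(* Shifting by an equilibrium with P_i = Pi (the equation for K is solvable since
   Pi A = B Pi and the graph is connected) turns (D) into a linear system
   x' = x M on the space P_i 1 = 0. There |x|^2 / 2 is a Lyapunov function: all
   cross terms cancel, and the dissipation q(x) = - <x, x M> is the sum of the
   residuals |P_i a_i - y_i|^2, |b_i^T P_i - z_i^T|^2 and of the Laplacian
   energies of P and Upsilon. Four consecutive iterates of M with q = 0 force
   x M^2 = 0, hence x M = 0 because M is dissipative. Adding to |x|^2 cross terms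
   between the dissipations of successive iterates (hypocoercivity) gives a
   strict quadratic Lyapunov function on the image of M, which complements its
   kernel. So x(t) converges exponentially to its component in ker M. On ker M
   one has P A = B P and P 1 = 0, i.e. Pi^T P commutes with A and kills 1, so
   friendliness forces P = 0. *)
From HB Require Import structures.
Require Import Defs.
From mathcomp Require Import all_boot all_order all_algebra.
From mathcomp Require Import all_classical all_reals all_analysis.
From mathcomp Require Import ring lra.
Set Implicit Arguments.
Unset Strict Implicit.
Unset Printing Implicit Defensive.
Import Order.TTheory GRing.Theory Num.Theory.
Import numFieldNormedType.Exports.
Local Open Scope classical_set_scope.
Local Open Scope ring_scope.

(** * Frobenius inner product and positive semidefinite forms *)

Lemma discriminant_le0 (R : realFieldType) (a b c : R) :
  (forall s t, 0 <= s ^+ 2 * a + 2 * s * t * b + t ^+ 2 * c) -> b ^+ 2 <= a * c.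
Proof.
move=> H; have [a0|a0|a0] := ltgtP a 0.
- by exfalso; have := H 1 0; lra.
(* At [(- b, a)] the form equals [a * (a * c - b ^+ 2)]. *)
- by rewrite -(ler_pM2l a0); have := H (- b) a; lra.
- have [->|b0] := eqVneq b 0; first by rewrite a0 mul0r expr0n.
  (* As [a = 0], the form is [- c - 2] at this point, while [H 0 1] gives [0 <= c]. *)
  have := H (- (c + 1) / b) 1.
  have -> : 2 * (- (c + 1) / b) * 1 * b = - (2 * (c + 1)) by field.
  by have := H 0 1; rewrite a0; lra.
Qed.

Section FrobeniusInnerProduct.
Context {R : realType}.

Definition fdot {m k} (M N : 'M[R]_(m, k)) : R := \tr (M *m N^T).

Lemma fdotE m k (M N : 'M[R]_(m, k)) :
  fdot M N = \sum_i \sum_j M i j * N i j.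
Proof.
by apply: eq_bigr => i _; rewrite mxE; apply: eq_bigr => j _; rewrite mxE.
Qed.

Lemma sqnormFE m k (M : 'M[R]_(m, k)) : sqnormF M = fdot M M.
Proof. by rewrite fdotE. Qed.

Lemma fdotC m k (M N : 'M[R]_(m, k)) : fdot M N = fdot N M.
Proof. by rewrite /fdot -mxtrace_tr trmx_mul trmxK. Qed.

Lemma fdotDl m k (M N P : 'M[R]_(m, k)) : fdot (M + N) P = fdot M P + fdot N P.
Proof. by rewrite /fdot mulmxDl linearD. Qed.

Lemma fdotZl m k a (M P : 'M[R]_(m, k)) : fdot (a *: M) P = a * fdot M P.
Proof. by rewrite /fdot -scalemxAl linearZ. Qed.

Lemma fdotNl m k (M P : 'M[R]_(m, k)) : fdot (- M) P = - fdot M P.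
Proof. by rewrite -scaleN1r fdotZl mulN1r. Qed.

Lemma fdotDr m k (M N P : 'M[R]_(m, k)) : fdot P (M + N) = fdot P M + fdot P N.
Proof. by rewrite !(fdotC P) fdotDl. Qed.

Lemma fdotZr m k a (M P : 'M[R]_(m, k)) : fdot P (a *: M) = a * fdot P M.
Proof. by rewrite !(fdotC P) fdotZl. Qed.

Lemma fdotNr m k (M P : 'M[R]_(m, k)) : fdot P (- M) = - fdot P M.
Proof. by rewrite !(fdotC P) fdotNl. Qed.

Definition fdotlin :=
  (@fdotDl, @fdotDr, @fdotNl, @fdotNr, @fdotZl, @fdotZr).

Lemma fdot0l m k (M : 'M[R]_(m, k)) : fdot 0 M = 0.
Proof. by rewrite -(scale0r (0 : 'M[R]_(m, k))) fdotZl mul0r. Qed.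

Lemma fdot_suml m k (I : Type) (r : seq I) (F : I -> 'M[R]_(m, k)) P :
  fdot (\sum_(i <- r) F i) P = \sum_(i <- r) fdot (F i) P.
Proof. by rewrite /fdot mulmx_suml linear_sum. Qed.

Lemma fdot_sumr m k (I : Type) (r : seq I) (F : I -> 'M[R]_(m, k)) P :
  fdot P (\sum_(i <- r) F i) = \sum_(i <- r) fdot P (F i).
Proof. by rewrite fdotC fdot_suml; apply: eq_bigr => i _; rewrite fdotC. Qed.

Lemma fdot_tr m k (M N : 'M[R]_(m, k)) : fdot M^T N^T = fdot M N.
Proof. by rewrite /fdot trmxK mxtrace_mulC -mxtrace_tr trmx_mul trmxK. Qed.

Lemma fdot_mulr m k l (M : 'M[R]_(m, k)) (A : 'M[R]_(k, l)) N :
  fdot (M *m A) N = fdot M (N *m A^T).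
Proof. by rewrite /fdot trmx_mul trmxK mulmxA. Qed.

Lemma fdot_mull m k l (A : 'M[R]_(m, k)) (M : 'M[R]_(k, l)) N :
  fdot (A *m M) N = fdot M (A^T *m N).
Proof. by rewrite -fdot_tr trmx_mul fdot_mulr -trmx_mul fdot_tr. Qed.

Lemma sqnormF_ge0 m k (M : 'M[R]_(m, k)) : 0 <= sqnormF M.
Proof. by apply: sumr_ge0 => i _; apply: sumr_ge0 => j _; rewrite sqr_ge0. Qed.

Lemma sqnormF_eq0 m k (M : 'M[R]_(m, k)) : sqnormF M = 0 -> M = 0.
Proof.
have H0 i : 0 <= \sum_j M i j ^+ 2 by apply: sumr_ge0 => j _; rewrite sqr_ge0.
move=> /eqP; rewrite psumr_eq0 => [/allP H|i _//]; apply/matrixP => i j.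
have /= := H i; rewrite mem_index_enum => /(_ isT).
rewrite psumr_eq0 => [/allP/(_ j)|k' _]; last by rewrite sqr_ge0.
by rewrite mem_index_enum mxE sqrf_eq0 => /(_ isT)/eqP.
Qed.

Lemma fdot_young m k (M N : 'M[R]_(m, k)) :
  2 * `|fdot M N| <= sqnormF M + sqnormF N.
Proof.
have := sqnormF_ge0 (M + N); have := sqnormF_ge0 (M - N).
rewrite !sqnormFE !fdotlin (fdotC N M); case: (ger0P (fdot M N)); lra.
Qed.

Lemma fdot_CauchySchwarz m k (M N : 'M[R]_(m, k)) :
  fdot M N ^+ 2 <= sqnormF M * sqnormF N.
Proof.
apply: discriminant_le0 => s t; have := sqnormF_ge0 (s *: M + t *: N).
by rewrite !sqnormFE !fdotlin (fdotC N M); lra.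
Qed.

(** Cauchy-Schwarz for each entry of the product, the inner product of a row of [M] and a column of
    [A]. *)
Lemma sqnormF_mulmx m k l (M : 'M[R]_(m, k)) (A : 'M[R]_(k, l)) :
  sqnormF (M *m A) <= sqnormF M * sqnormF A.
Proof.
have -> : sqnormF A = \sum_j \sum_i A i j ^+ 2 by exact: exchange_big.
rewrite big_distrl/=; apply: ler_sum => i _.
rewrite big_distrr/=; apply: ler_sum => j _.
have := fdot_CauchySchwarz (row i M) (col j A)^T.
rewrite fdotE /sqnormF !big_ord1 mxE; congr (_ ^+ 2 <= _ * _).
- by apply: eq_bigr => k' _; rewrite !mxE.
- by apply: eq_bigr => k' _; rewrite !mxE.
- by apply: eq_bigr => k' _; rewrite !mxE.
Qed.

Lemma fdot_form_bound N (T : 'M[R]_N) :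
  exists2 C : R, 0 < C & forall x : 'rV[R]_N, `|fdot (x *m T) x| <= C * sqnormF x.
Proof.
exists (sqnormF T + 1) => [|x]; first by have := sqnormF_ge0 T; lra.
have := fdot_young (x *m T) x; have := sqnormF_mulmx x T; have := sqnormF_ge0 x.
by have := normr_ge0 (fdot (x *m T) x); nra.
Qed.

(* [q(v) q(xG)] dominates [|xG|^4] for a positive semidefinite form [q], so
   [q] controls [|xG|^2]; and [L] factors through [G]. *)
Lemma psd_form_dominates N p (G : 'M[R]_N) (L : 'M[R]_(N, p)) :
  G^T = G -> (forall x : 'rV[R]_N, 0 <= fdot (x *m G) x) ->
  (forall x : 'rV[R]_N, fdot (x *m G) x = 0 -> x *m L = 0) ->
  exists2 C : R, 0 < C &
    forall x : 'rV[R]_N, sqnormF (x *m L) <= C * fdot (x *m G) x.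
Proof.
move=> Gsym Gpsd GL.
have CS (x y : 'rV[R]_N) : fdot (x *m G) y ^+ 2 <= fdot (x *m G) x * fdot (y *m G) y.
  have sym : fdot (y *m G) x = fdot (x *m G) y by rewrite fdot_mulr Gsym fdotC.
  apply: discriminant_le0 => s t; have := Gpsd (s *: x + t *: y).
  by rewrite mulmxDl -!scalemxAl !fdotlin sym; lra.
have [B B0 HB] := fdot_form_bound G.
have step (x : 'rV[R]_N) : sqnormF (x *m G) <= B * fdot (x *m G) x.
  have := CS x (x *m G); rewrite -sqnormFE.
  have := le_trans (ler_norm _) (HB (x *m G)).
  have := Gpsd x; have := sqnormF_ge0 (x *m G).
  set u := sqnormF _; set v := fdot _ _; set z := fdot _ _.
  rewrite le_eqVlt => /predU1P[<- ? ? ?|u0 v0 H1 H2]; first by rewrite mulr_ge0// ltW.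
  by rewrite -(ler_pM2l u0); nra.
have kerGL : (kermx G <= kermx L)%MS.
  apply/row_subP => i; apply/sub_kermxP; apply: GL.
  have /sub_kermxP -> : (row i (kermx G) <= kermx G)%MS by exact: row_sub.
  by rewrite fdot0l.
(* The inclusion of left kernels is dualised: the transposed cokernel of [G^T] lies in the kernel of
   [G], hence kills [L]. *)
have [X ->] : exists X, L = G *m X.
  suff /submxP[D LD] : (L^T <= G^T)%MS.
    by exists D^T; apply: trmx_inj; rewrite trmx_mul trmxK -LD.
  rewrite submxE -[cokermx _]trmxK -trmx_mul.
  rewrite -subr_eq0 subr0 trmx_eq0.
  have /sub_kermxP : ((cokermx G^T)^T <= kermx G)%MS.
    by apply/sub_kermxP; apply: trmx_inj; rewrite trmx_mul trmxK trmx0 mulmx_coker.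
  by move=> /sub_kermxP/submx_trans/(_ kerGL)/sub_kermxP->.
exists (B * (sqnormF X + 1)) => [|x]; first by have := sqnormF_ge0 X; nra.
rewrite mulmxA; have := sqnormF_mulmx (x *m G) X; have := step x.
by have := sqnormF_ge0 X; have := sqnormF_ge0 (x *m G); have := Gpsd x; nra.
Qed.

End FrobeniusInnerProduct.

(** * Strict Lyapunov functions for dissipative matrices *)

Section DissipativeMatrix.
Context {R : realType} {N : nat}.
Variable M : 'M[R]_N.
Hypothesis dissip : forall x : 'rV[R]_N, fdot x (x *m M) <= 0.
Implicit Types (x y : 'rV[R]_N) (T : 'M[R]_N).

Definition mxpow (k : nat) : 'M[R]_N := locked (iter k (mulmx^~ M) 1%:M).

Lemma mulmx_mxpow0 x : x *m mxpow 0 = x.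
Proof. by rewrite /mxpow -lock mulmx1. Qed.

Lemma mulmx_mxpowS x k : x *m mxpow k.+1 = x *m mxpow k *m M.
Proof. by rewrite /mxpow -!lock iterS mulmxA. Qed.

Lemma mulmx_mxpowSr x k : x *m mxpow k.+1 = x *m M *m mxpow k.
Proof.
elim: k => [|k IH]; first by rewrite mulmx_mxpowS !mulmx_mxpow0.
by rewrite mulmx_mxpowS IH -mulmx_mxpowS.
Qed.

Definition dissipation x : R := - fdot x (x *m M).

(* Derivative of [fdot (x *m T) x] along the flow [x' = x *m M]. *)
Definition lie T x : R := fdot (x *m M *m T) x + fdot (x *m T) (x *m M).

Lemma lieD T U x : lie (T + U) x = lie T x + lie U x.
Proof. by rewrite /lie !mulmxDr !fdotDl; ring. Qed.

Lemma lieZ a T x : lie (a *: T) x = a * lie T x.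
Proof. by rewrite /lie -!scalemxAr !fdotZl; ring. Qed.

Lemma lie1 x : lie 1%:M x = - 2 * dissipation x.
Proof. by rewrite /lie !mulmx1 /dissipation (fdotC (x *m M)); ring. Qed.

Lemma dissipation_ge0 x : 0 <= dissipation x.
Proof. by rewrite oppr_ge0. Qed.

(** The symmetric bilinear form that polarises [dissipation]. *)
Definition cross x y : R := - (fdot x (y *m M) + fdot y (x *m M)) / 2.

(** Expansion of [0 <= dissipation (c *: x + y)]. *)
Lemma cross_young (c : R) x y :
  - (2 * c * cross x y) <= c ^+ 2 * dissipation x + dissipation y.
Proof.
have := dissipation_ge0 (c *: x + y); rewrite /dissipation /cross.
by rewrite mulmxDl -scalemxAl !fdotlin; lra.
Qed.

(** Matrix of the quadratic form [cross (x *m mxpow k) (x *m mxpow k.+1)] in [x]. *)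
Definition cross_form k : 'M[R]_N :=
  - 2^-1 *: (mxpow k *m (mxpow k.+2)^T + mxpow k.+1 *m (mxpow k.+1)^T).

Lemma fdot_cross_form k x y : fdot (x *m cross_form k) y =
  - 2^-1 * (fdot (x *m mxpow k) (y *m mxpow k.+2)
          + fdot (x *m mxpow k.+1) (y *m mxpow k.+1)).
Proof.
by rewrite -scalemxAr fdotZl mulmxDr fdotDl !mulmxA !(fdot_mulr _ _^T) !trmxK.
Qed.

(** Product rule: the flow raises one argument of [cross] by one level, and on the diagonal [cross]
    is [dissipation]. *)
Lemma lie_cross_form k x : lie (cross_form k) x =
  dissipation (x *m mxpow k.+1) + cross (x *m mxpow k) (x *m mxpow k.+2).
Proof.
rewrite /lie !fdot_cross_form /dissipation /cross -!mulmx_mxpowSr -!mulmx_mxpowS.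
rewrite (fdotC (x *m mxpow k.+2) (x *m mxpow k.+1)); lra.
Qed.

(* Villani's hypocoercivity correctors: the cross term between consecutive
   levels trades the dissipation at level [k.+1] for that at levels [k] and
   [k.+2], the latter with an arbitrarily small coefficient. *)
Lemma hypocoercive_corrector m (eta : R) : 0 < eta ->
  exists T C, 0 < C /\ forall x, lie T x <= C * dissipation x
    - \sum_(1 <= k < m.+1) dissipation (x *m mxpow k)
    + eta * dissipation (x *m mxpow m.+1).
Proof.
elim: m eta => [|m IH] eta eta0.
  exists 0, 1; split=> // x; rewrite big_geq//.
  have := dissipation_ge0 x; have := dissipation_ge0 (x *m mxpow 1).
  by rewrite /lie !mulmx0 !fdot0l; nra.
(* Scaling by [s] turns the inductive error term into one copy of the dissipation at level [m.+1],
   covered by half of the gain from [- 2 *: cross_form m]. In [s], the part 1 preserves the sum and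
   the part [eta^-1] pays for level [m] in [cross_young]. *)
pose s := 1 + eta^-1; have s1 : 1 <= s by rewrite lerDl invr_ge0 ltW.
have s0 : 0 < s by lra.
have is0 : 0 < s^-1 by rewrite invr_gt0.
have [T [C [C0 HT]]] := IH _ is0.
exists (s *: T - 2 *: cross_form m), (s * C + s); split => [|x]; first by nra.
rewrite lieD -scaleNr (lieZ s) (lieZ (-2)) lie_cross_form.
have ie0 : 0 < eta^-1 by rewrite invr_gt0.
have ee : eta * eta^-1 = 1 by rewrite mulfV// gt_eqF.
have ss : s * s^-1 = 1 by rewrite mulfV// gt_eqF.
have HT' := HT x; rewrite -(ler_pM2l s0) in HT'.
have Y := cross_young eta^-1 (x *m mxpow m) (x *m mxpow m.+2).
rewrite -(ler_pM2l eta0) in Y.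
rewrite (big_nat_recr m.+1)//=.
set S := \sum_(_ <= _ < _) _ in HT' *.
have S0 : 0 <= S by apply: sumr_ge0 => k _; exact: dissipation_ge0.
(* Level [m] is a term of the sum unless [m = 0], where it is [dissipation x] itself. *)
have Sm : m = 0%N \/ dissipation (x *m mxpow m) <= S.
  case: (m) @S S0 {HT'} => [|m'] S S0; [by left | right].
  rewrite /S (big_nat_recr m'.+1)//= lerDr.
  by apply: sumr_ge0 => k _; exact: dissipation_ge0.
have q0 : 0 <= dissipation x by exact: dissipation_ge0.
have q1 : 0 <= dissipation (x *m mxpow m.+1) by exact: dissipation_ge0.
have q2 : 0 <= dissipation (x *m mxpow m.+2) by exact: dissipation_ge0.
have {}Sm : dissipation (x *m mxpow m) <= S + dissipation x.
  by case: Sm => [->|]; [rewrite mulmx_mxpow0|]; lra.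
move: HT' Y q0 q1 q2 Sm; clearbody S.
set a := dissipation x; set b := dissipation (x *m mxpow m.+1).
set c := dissipation (x *m mxpow m.+2).
set d := dissipation (x *m mxpow m); set X := cross _ _.
move=> HT' Y a0 b0 c0 Sm.
have e1 : s * (C * a - S + s^-1 * b) = s * C * a - s * S + b.
  by transitivity (s * C * a - s * S + s * s^-1 * b); [ring | rewrite ss; ring].
have e2 : eta * - (2 * eta^-1 * X) = - 2 * X.
  by transitivity (eta * eta^-1 * (- 2 * X)); [ring | rewrite ee mul1r].
have e3 : eta * (eta^-1 ^+ 2 * d + c) = eta^-1 * d + eta * c.
  by transitivity (eta * eta^-1 * (eta^-1 * d) + eta * c); [ring | rewrite ee mul1r].
have e4 : s * S = S + eta^-1 * S by rewrite /s; ring.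
have e5 : s * a = a + eta^-1 * a by rewrite /s; ring.
have e6 : eta^-1 * d <= eta^-1 * (S + a) by rewrite ler_pM2l.
rewrite e1 e4 in HT'; rewrite e2 e3 in Y.
lra.
Qed.

(** With [v = x *m M] killed by [M], dissipativity at [s *: v + x] is affine in [s] with slope
    [sqnormF v], so this slope cannot be positive. *)
Lemma dissipative_ker_sqr x : x *m M *m M = 0 -> x *m M = 0.
Proof.
set v := x *m M => vM; apply: sqnormF_eq0.
have := sqnormF_ge0 v; rewrite le_eqVlt => /predU1P[//|v0].
have key (s : R) : s * sqnormF v + fdot x v <= 0.
  have := dissip (s *: v + x).
  by rewrite mulmxDl -scalemxAl vM scaler0 add0r fdotDl fdotZl sqnormFE.
have := key ((1 - fdot x v) / sqnormF v).
by rewrite divfK ?gt_eqF//; lra.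
Qed.

(** By [dissipative_ker_sqr] kernel and image meet trivially; rank-nullity does the rest. *)
Lemma dissipative_decomposition : (kermx M + M :=: 1%:M)%MS.
Proof.
apply/eqmxP; rewrite submx1 sub1mx -col_leq_rank.
have cap0 : (kermx M :&: M)%MS = 0.
  apply/eqP/rowV0P => v; rewrite sub_capmx => /andP[/sub_kermxP vM /submxP[u uE]].
  by rewrite uE in vM *; exact: dissipative_ker_sqr.
have := mxrank_sum_cap (kermx M) M.
by rewrite cap0 mxrank0 addn0 mxrank_ker (subnK (rank_leq_row M)) => ->/=.
Qed.

Variable m : nat.
Hypothesis observable : forall x,
  (forall k, (k <= m)%N -> dissipation (x *m mxpow k) = 0) -> x *m M = 0.

(** Symmetrised, as [psd_form_dominates] requires; it plays the role of an observability Gramian. *)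
Definition dissipation_form : 'M[R]_N := - 2^-1 *: \sum_(0 <= k < m.+1)
  (mxpow k *m (mxpow k.+1)^T + mxpow k.+1 *m (mxpow k)^T).

Lemma fdot_dissipation_form x : fdot (x *m dissipation_form) x =
  \sum_(0 <= k < m.+1) dissipation (x *m mxpow k).
Proof.
rewrite -scalemxAr fdotZl mulmx_sumr fdot_suml mulr_sumr; apply: eq_bigr => k _.
rewrite mulmxDr fdotDl !mulmxA !(fdot_mulr _ _^T) !trmxK /dissipation.
by rewrite mulmx_mxpowS (fdotC (_ *m M)); lra.
Qed.

(** If all these dissipations vanish, observability gives [y *m M *m M = 0], hence [y *m M = 0];
    [psd_form_dominates] makes this quantitative. *)
Lemma coercive_on_image : exists2 C : R, 0 < C & forall y,
  sqnormF (y *m M) <= C * \sum_(0 <= k < m.+1) dissipation (y *m M *m mxpow k).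
Proof.
have E y : fdot (y *m (M *m dissipation_form *m M^T)) y =
    \sum_(0 <= k < m.+1) dissipation (y *m M *m mxpow k).
  by rewrite !mulmxA (fdot_mulr _ M^T) trmxK fdot_dissipation_form.
have [||y|C C0 HC] := psd_form_dominates (G := M *m dissipation_form *m M^T) (L := M).
- rewrite !trmx_mul trmxK mulmxA; congr (_ *m _ *m _).
  rewrite /dissipation_form linearZ/= linear_sum/=; congr (_ *: _).
  by apply: eq_bigr => k _; rewrite linearD/= !trmx_mul !trmxK addrC.
- by move=> y; rewrite E; apply: sumr_ge0 => k _; exact: dissipation_ge0.
- move=> /eqP; rewrite E big_mkord psumr_eq0 => [/allP H|k _]; last exact: dissipation_ge0.
  apply/dissipative_ker_sqr/observable => k km.
  have := H (Ordinal (km : (k < m.+1)%N)); rewrite mem_index_enum/=.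
  by move=> /(_ isT)/eqP.
by exists C => // y; rewrite -E.
Qed.

Lemma strict_lyapunov : exists T (K b : R), 0 < b /\ forall y, let w := y *m M in
  [/\ sqnormF w <= fdot (w *m T) w, fdot (w *m T) w <= K * sqnormF w &
      lie T w <= - b * fdot (w *m T) w].
Proof.
have [C C0 HC] := coercive_on_image.
have [D D0 HD] : exists2 D : R, 0 < D &
    forall x, dissipation (x *m mxpow m.+1) <= D * sqnormF x.
  have [D D0 HD] := fdot_form_bound (mxpow m.+1 *m (mxpow m.+2)^T).
  exists D => // x; apply: le_trans (HD x).
  rewrite mulmxA (fdot_mulr _ _^T) trmxK -normrN /dissipation -mulmx_mxpowS; exact: ler_norm.
(* This [eta] makes the remainder at level [m.+1] at most half of the total dissipation, by [HD] and
   [HC]. *)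
have eta0 : 0 < (2 * (D * C))^-1 by rewrite invr_gt0 !mulr_gt0.
have [T [C1 [C10 HT]]] := hypocoercive_corrector m eta0.
have [B B0 HB] := fdot_form_bound T.
(* The corrector [T] is indefinite. The multiple [B + 1] of the squared norm makes the form at least
   [sqnormF], and [C1] absorbs the term [C1 * dissipation x]. *)
pose W := (C1 + B + 1) *: 1%:M + T.
have WE x : fdot (x *m W) x = (C1 + B + 1) * sqnormF x + fdot (x *m T) x.
  by rewrite mulmxDr -scalemxAr mulmx1 !fdotlin sqnormFE.
pose K := C1 + B + 1 + B; have K0 : 0 < K by rewrite /K; lra.
(* The derivative is at most minus half the total dissipation, which is at least [sqnormF w / C],
   and the form is at most [K * sqnormF w]. *)
exists W, K, (2 * C * K)^-1; split; first by rewrite invr_gt0 !mulr_gt0.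
move=> y w; have w0 := sqnormF_ge0 w.
have := HB w; rewrite ler_norml => /andP[Tlo Thi].
have UB : fdot (w *m W) w <= K * sqnormF w by rewrite WE /K; lra.
split=> //; first by rewrite WE; nra.
have S := HC y; rewrite -/w in S.
have H := HT w.
set Q := \sum_(0 <= _ < _) _ in S.
have QE : Q = dissipation w + \sum_(1 <= k < m.+1) dissipation (w *m mxpow k).
  by rewrite /Q big_nat_recl// mulmx_mxpow0 big_add1.
have H1 : (2 * (D * C))^-1 * dissipation (w *m mxpow m.+1) <= Q / 2.
  rewrite mulrC ler_pdivrMr ?mulr_gt0//.
  by apply: le_trans (HD w) _; rewrite -(ler_pM2l D0) in S; lra.
have L : lie W w <= - (Q / 2).
  rewrite lieD lieZ lie1; have := dissipation_ge0 w; nra.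
apply: le_trans L _; rewrite mulNr lerN2 mulrC ler_pdivrMr ?mulr_gt0//.
apply: le_trans UB _; rewrite -(ler_pM2l K0) in S; lra.
Qed.

End DissipativeMatrix.

(** * Calculus of scalar rates on the half-line and exponential decay *)

Section ScalarVelocity.
Context {R : realType}.
Implicit Types (f g df dg : R -> R).

(** Scalar counterpart of [has_velocity], meant for single coordinates. *)
Definition has_rate f df : Prop :=
  {within `[0, +oo[%classic, continuous f} /\
  forall t : R, 0 < t -> is_derive t (1 : R) f (df t).

Lemma has_rate_eq f g df dg : f =1 g -> (forall t, 0 < t -> df t = dg t) ->
  has_rate f df -> has_rate g dg.
Proof.
by move=> /funext-> E [cg dgE]; split=> // t t0; rewrite -E//; exact: dgE.
Qed.

Lemma has_rate_cst (a : R) : has_rate (fun=> a) (fun=> 0).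
Proof.
split=> [|t _]; last exact: is_derive_cst.
by move=> x; exact: cvg_cst.
Qed.

Lemma has_rateD f g df dg : has_rate f df -> has_rate g dg ->
  has_rate (fun t => f t + g t) (fun t => df t + dg t).
Proof.
move=> [cf ff] [cg gg]; split=> [x|t t0]; first exact: cvgD (cf x) (cg x).
by apply: is_deriveD; [exact: ff|exact: gg].
Qed.

Lemma has_rateM f g df dg : has_rate f df -> has_rate g dg ->
  has_rate (fun t => f t * g t) (fun t => df t * g t + f t * dg t).
Proof.
move=> [cf ff] [cg gg]; split=> [x|t t0]; first exact: cvgM (cf x) (cg x).
have Ef := ff t t0; have Eg := gg t t0.
by apply: (is_derive_eq (is_deriveM Ef Eg)); rewrite addrC /= [X in X + _]mulrC.
Qed.

Lemma has_rateZ (a : R) f df : has_rate f df ->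
  has_rate (fun t => a * f t) (fun t => a * df t).
Proof.
move=> /(has_rateM (has_rate_cst a)); apply: has_rate_eq => // t _.
by rewrite mul0r add0r.
Qed.

Lemma has_rate_sum (I : Type) (r : seq I) (F dF : I -> R -> R) :
  (forall i, has_rate (F i) (dF i)) ->
  has_rate (fun t => \sum_(i <- r) F i t) (fun t => \sum_(i <- r) dF i t).
Proof.
move=> H; elim: r => [|i r IH].
  by apply: has_rate_eq (has_rate_cst 0) => [t|t _]; rewrite big_nil.
by apply: has_rate_eq (has_rateD (H i) IH) => [t|t _]; rewrite big_cons.
Qed.

Lemma has_rate_expR (a : R) :
  has_rate (fun t => expR (a * t)) (fun t => a * expR (a * t)).
Proof.
have D t : is_derive t (1 : R) (fun t => expR (a * t)) (a * expR (a * t)).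
  have Da : is_derive t (1 : R) (fun t => a * t) a.
    apply: (is_derive_eq (is_deriveZ a (is_derive_id t (1 : R)))).
    by rewrite /GRing.scale/= mulr1.
  rewrite [a * expR _]mulrC.
  exact: (@is_derive1_comp _ expR (fun t => a * t) _ _ _ (is_derive_expR _) Da).
split=> [|t _]; last exact: D.
apply: continuous_subspaceT => t; apply: differentiable_continuous.
by apply/derivable1_diffP; exact: (@ex_derive _ _ _ _ _ _ _ (D t)).
Qed.

Lemma has_rate_nonincreasing f df : has_rate f df ->
  (forall t, 0 < t -> df t <= 0) -> forall t, 0 <= t -> f t <= f 0.
Proof.
move=> [cf ff] df0 t t0; apply: (@ler0_derive1_nincry _ f 0) => // s.
  by rewrite in_itv/= andbT => s0; have E := ff s s0; exact: ex_derive.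
rewrite in_itv/= andbT => s0; rewrite derive1E.
by have E := ff s s0; rewrite derive_val; exact: df0.
Qed.

(** Integrating factor: [expR (b * t) * f t] is nonincreasing. *)
Lemma gronwall_decay f df (b : R) : has_rate f df ->
  (forall t, 0 < t -> df t <= - b * f t) ->
  forall t, 0 <= t -> f t <= expR (- b * t) * f 0.
Proof.
move=> ff dfb t t0.
have := has_rate_nonincreasing (has_rateM (has_rate_expR b) ff) _ t0.
rewrite mulr0 expR0 mul1r mulNr expRN => H.
rewrite mulrC ler_pdivlMr ?expR_gt0// mulrC; apply: H => s s0.
have := dfb s s0; have := expR_gt0 (b * s); nra.
Qed.

End ScalarVelocity.

(** * Exponential convergence of dissipative, observable linear flows *)

Section LinearFlow.
Context {R : realType} {N : nat}.

Definition flow_of (M : 'M[R]_N) (x : R -> 'rV[R]_N) : Prop :=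
  forall k, has_rate (fun t => x t 0 k) (fun t => (x t *m M) 0 k).

Lemma flow_of_sub (M : 'M[R]_N) x k :
  flow_of M x -> k *m M = 0 -> flow_of M (fun t => x t - k).
Proof.
move=> Mx kM j; apply: has_rate_eq (has_rateD (Mx j) (has_rate_cst (- k 0 j))).
- by move=> t; rewrite !mxE.
- by move=> t _; rewrite mulmxBl kM subr0 addr0.
Qed.

Lemma has_rate_form (M T : 'M[R]_N) x : flow_of M x ->
  has_rate (fun t => fdot (x t *m T) (x t)) (fun t => lie M T (x t)).
Proof.
move=> Mx.
have H := @has_rate_sum R _ (index_enum 'I_N) _ _ (fun j => has_rateM
  (@has_rate_sum R _ (index_enum 'I_N) _ _ (fun i => has_rateZ (T i j) (Mx i))) (Mx j)).
have E (y z : 'rV[R]_N) : fdot (y *m T) z = \sum_j (\sum_i T i j * y 0 i) * z 0 j :> R.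
  rewrite fdotE big_ord1; apply: eq_bigr => j _; rewrite mxE; congr (_ * _).
  by apply: eq_bigr => i _; rewrite mulrC.
by apply: has_rate_eq H => [t|t _]; rewrite /lie !E// -big_split.
Qed.

Variables (M : 'M[R]_N) (m : nat).
Hypothesis dissip : forall x : 'rV[R]_N, fdot x (x *m M) <= 0.
Hypothesis observable : forall x : 'rV[R]_N,
  (forall k, (k <= m)%N -> dissipation M (x *m mxpow M k) = 0) -> x *m M = 0.

(** The component [k] of [x 0] in the kernel is stationary, and the rest stays in the image of [M],
    where [strict_lyapunov] applies. The decomposition of [x 0] is part of the conclusion so that
    linear constraints can be transferred from [x 0] to [k]. *)
Theorem dissipative_flow_cvg : exists c a : R, 0 < c /\ 0 < a /\
  forall x, flow_of M x -> exists k y,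
    [/\ k *m M = 0, x 0 = k + y *m M & forall t, 0 <= t ->
      Num.sqrt (sqnormF (x t - k))
      <= c * expR (- a * t) * Num.sqrt (sqnormF (x 0 - k))].
Proof.
have [T [K [b [b0 HT]]]] := strict_lyapunov dissip observable.
(* The sign of [K] is not known, hence the absolute value; the rate is halved because norms are
   square roots of the Lyapunov function. *)
exists (Num.sqrt (`|K| + 1)), (b / 2); split; first by rewrite sqrtr_gt0; have := normr_ge0 K; lra.
split=> [|x Mx]; first by lra.
have /sub_addsmxP[[u y] /= x0E] : (x 0%R <= kermx M + M)%MS.
  by rewrite (dissipative_decomposition dissip) submx1.
have kM : u *m kermx M *m M = 0 by rewrite -mulmxA mulmx_ker mulmx0.
exists (u *m kermx M), y; split=> // t t0.
set k := u *m _ in x0E kM *; pose w t := x t - k.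
have Mw : flow_of M w by exact: flow_of_sub.
(* Membership in the image is tested on the cokernel [C]: [sqnormF (w t *m C)] has zero derivative
   because [M *m C = 0], and it starts at 0. *)
have wM s : 0 <= s -> exists y, w s = y *m M.
  move=> s0; suff : (w s <= M)%MS by move=> /submxP.
  rewrite submxE; have MC := mulmx_coker M; move: (cokermx M) MC => C MC.
  apply/eqP/sqnormF_eq0.
  have fE (z : 'rV[R]_N) : sqnormF (z *m C) = fdot (z *m (C *m C^T)) z.
    by rewrite sqnormFE mulmxA (fdot_mulr _ C^T) trmxK.
  apply/eqP; rewrite eq_le sqnormF_ge0 andbT fE.
  have := has_rate_nonincreasing (has_rate_form (C *m C^T) Mw) _ s0.
  have w0C : w 0 *m C = 0 by rewrite /w x0E addrC addKr -mulmxA MC mulmx0.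
  rewrite -!fE w0C [X in _ <= X]sqnormFE fdot0l.
  apply=> r _; rewrite /lie mulmxA -(mulmxA _ M) MC mulmx0 mul0mx fdot0l add0r.
  by rewrite mulmxA fdot_mulr trmxK -mulmxA MC mulmx0 fdotC fdot0l.
have W t' : 0 <= t' -> [/\ sqnormF (w t') <= fdot (w t' *m T) (w t'),
    fdot (w t' *m T) (w t') <= K * sqnormF (w t') &
    lie M T (w t') <= - b * fdot (w t' *m T) (w t')].
  by move=> /wM[z ->]; exact: HT.
have [_ W0 _] := W 0 (lexx _); have [Wt _ _] := W t t0.
have D : fdot (w t *m T) (w t) <= expR (- b * t) * fdot (w 0 *m T) (w 0).
  apply: (gronwall_decay (has_rate_form T Mw)) => // s s0.
  by have [_ _] := W s (ltW s0).
have -> : expR (- (b / 2) * t) = Num.sqrt (expR (- b * t)).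
  have -> : - b * t = - (b / 2) * t + - (b / 2) * t by lra.
  by rewrite expRD -expr2 sqrtr_sqr ger0_norm// expR_ge0.
rewrite -!sqrtrM ?mulr_ge0 ?expR_ge0 ?addr_ge0//; apply: ler_wsqrtr.
apply: (le_trans Wt); apply: (le_trans D).
rewrite [leRHS](_ : _ = expR (- b * t) * ((`|K| + 1) * sqnormF (w 0))); last by rewrite /w; ring.
rewrite ler_wpM2l ?expR_ge0//; apply: (le_trans W0).
have := ler_norm K; have := sqnormF_ge0 (w 0); nra.
Qed.

End LinearFlow.

(** * States as row vectors, and linearity of the vector field *)

Section StateCoordinates.
Context {R : realType} {n : nat}.
Implicit Types Q : state R n.

Definition idx3 : finType := ('I_n * 'I_n * 'I_n)%type.
Definition idx2 : finType := ('I_n * 'I_n)%type.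
Definition idx : finType :=
  (idx3 + (idx3 + (idx3 + (idx3 + (idx2 + (idx2 + idx2))))))%type.

Definition entry Q (s : idx) : R :=
  match s with
  | inl (i, p, q) => Pv Q i p q
  | inr (inl (i, p, q)) => Kv Q i p q
  | inr (inr (inl (i, p, q))) => Thetav Q i p q
  | inr (inr (inr (inl (i, p, q)))) => Upsilonv Q i p q
  | inr (inr (inr (inr (inl (i, p))))) => yv Q i p 0
  | inr (inr (inr (inr (inr (inl (i, p)))))) => zv Q i p 0
  | inr (inr (inr (inr (inr (inr (i, p)))))) => lambdav Q i p 0
  end.

Lemma state_ext Q Q' : entry Q =1 entry Q' -> Q = Q'.
Proof.
case: Q Q' => [P K Th Up y z la] [P' K' Th' Up' y' z' la'] E.
congr State; apply/funext => i; apply/matrixP => p q; rewrite ?(ord1 q).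
- exact: (E (inl (i, p, q))).
- exact: (E (inr (inl (i, p, q)))).
- exact: (E (inr (inr (inl (i, p, q))))).
- exact: (E (inr (inr (inr (inl (i, p, q)))))).
- exact: (E (inr (inr (inr (inr (inl (i, p))))))).
- exact: (E (inr (inr (inr (inr (inr (inl (i, p)))))))).
- exact: (E (inr (inr (inr (inr (inr (inr (i, p)))))))).
Qed.

Definition enc Q : 'rV[R]_#|idx| := \row_k entry Q (enum_val k).

Definition dec (x : 'rV[R]_#|idx|) : state R n :=
  let X s := x 0 (enum_rank (s : idx)) in
  {| Pv i := \matrix_(p, q) X (inl (i, p, q));
     Kv i := \matrix_(p, q) X (inr (inl (i, p, q)));
     Thetav i := \matrix_(p, q) X (inr (inr (inl (i, p, q))));
     Upsilonv i := \matrix_(p, q) X (inr (inr (inr (inl (i, p, q)))));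
     yv i := \col_p X (inr (inr (inr (inr (inl (i, p))))));
     zv i := \col_p X (inr (inr (inr (inr (inr (inl (i, p)))))));
     lambdav i := \col_p X (inr (inr (inr (inr (inr (inr (i, p))))))) |}.

Lemma entry_dec x s : entry (dec x) s = x 0 (enum_rank s).
Proof.
by case: s => [[[i p] q]|[[[i p] q]|[[[i p] q]|[[[i p] q]|[[i p]|[[i p]|[i p]]]]]]];
  rewrite /= mxE.
Qed.

Lemma decK : cancel dec enc.
Proof. by move=> x; apply/rowP => k; rewrite mxE entry_dec enum_valK. Qed.

Lemma encK : cancel enc dec.
Proof. by move=> Q; apply: state_ext => s; rewrite entry_dec mxE enum_rankK. Qed.

(* [state] carries no module structure: [comb c Q Q'] stands for [c Q + Q']. *)
Definition comb (c : R) Q Q' : state R n :=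
  {| Pv i := c *: Pv Q i + Pv Q' i;
     Kv i := c *: Kv Q i + Kv Q' i;
     Thetav i := c *: Thetav Q i + Thetav Q' i;
     Upsilonv i := c *: Upsilonv Q i + Upsilonv Q' i;
     yv i := c *: yv Q i + yv Q' i;
     zv i := c *: zv Q i + zv Q' i;
     lambdav i := c *: lambdav Q i + lambdav Q' i |}.

Lemma entry_comb c Q Q' s : entry (comb c Q Q') s = c * entry Q s + entry Q' s.
Proof.
by case: s => [[[i p] q]|[[[i p] q]|[[[i p] q]|[[[i p] q]|[[i p]|[[i p]|[i p]]]]]]];
  rewrite /= !mxE.
Qed.

Lemma entry_zero s : entry (@zero_state R n) s = 0.
Proof.
by case: s => [[[i p] q]|[[[i p] q]|[[[i p] q]|[[[i p] q]|[[i p]|[[i p]|[i p]]]]]]];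
  rewrite /= mxE.
Qed.

Lemma state_eq0 Q :
  (forall i, Pv Q i = 0) -> (forall i, Kv Q i = 0) -> (forall i, Thetav Q i = 0) ->
  (forall i, Upsilonv Q i = 0) -> (forall i, yv Q i = 0) ->
  (forall i, zv Q i = 0) -> (forall i, lambdav Q i = 0) -> Q = zero_state.
Proof.
case: Q => /= P K T U y z l P0 K0 T0 U0 y0 z0 l0.
by congr State; apply/funext.
Qed.

Lemma entry_sub Q Q' s : entry (sub_state Q Q') s = entry Q s - entry Q' s.
Proof.
by case: s => [[[i p] q]|[[[i p] q]|[[[i p] q]|[[[i p] q]|[[i p]|[[i p]|[i p]]]]]]];
  rewrite /= !mxE.
Qed.

Lemma sub_stateE Q Q' : sub_state Q Q' = comb (-1) Q' Q.
Proof. by apply: state_ext => s; rewrite entry_sub entry_comb mulN1r addrC. Qed.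

Lemma dec_comb c x y : dec (c *: x + y) = comb c (dec x) (dec y).
Proof. by apply: state_ext => s; rewrite entry_comb !entry_dec !mxE. Qed.

Lemma enc_comb c Q Q' : enc (comb c Q Q') = c *: enc Q + enc Q'.
Proof. by apply/rowP => k; rewrite !mxE entry_comb. Qed.

Definition sdot Q Q' : R :=
  \sum_i (fdot (Pv Q i) (Pv Q' i) + fdot (Kv Q i) (Kv Q' i) +
          fdot (Thetav Q i) (Thetav Q' i) + fdot (Upsilonv Q i) (Upsilonv Q' i) +
          fdot (yv Q i) (yv Q' i) + fdot (zv Q i) (zv Q' i) +
          fdot (lambdav Q i) (lambdav Q' i)).

Lemma fdot_enc Q Q' : fdot (enc Q) (enc Q') = sdot Q Q'.
Proof.
rewrite fdotE big_ord1 (reindex _ (onW_bij _ (@enum_rank_bij idx)))/=.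
under eq_bigr do rewrite !mxE enum_rankK.
rewrite !big_sumType/= /sdot !big_split/= -!addrA.
have S3 (F G : 'I_n -> 'M[R]_n) : \sum_(s : idx3) (let: (i, p, q) := s in F i p q * G i p q)
    = \sum_i fdot (F i) (G i).
  rewrite (eq_bigr (fun s : idx3 => F s.1.1 s.1.2 s.2 * G s.1.1 s.1.2 s.2)); last by case=> [[]].
  rewrite -(pair_bigA _ (fun s q => F s.1 s.2 q * G s.1 s.2 q))/=.
  rewrite -(pair_bigA _ (fun i p => \sum_q F i p q * G i p q))/=.
  by apply: eq_bigr => i _; rewrite fdotE.
have S2 (F G : 'I_n -> 'cV[R]_n) : \sum_(s : idx2) (let: (i, p) := s in F i p 0 * G i p 0)
    = \sum_i fdot (F i) (G i).
  rewrite (eq_bigr (fun s : idx2 => F s.1 s.2 0 * G s.1 s.2 0)); last by case.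
  rewrite -(pair_bigA _ (fun i p => F i p 0 * G i p 0))/=.
  by apply: eq_bigr => i _; rewrite fdotE; apply: eq_bigr => p _; rewrite big_ord1.
rewrite -!S3 -!S2.
congr (_ + (_ + (_ + (_ + (_ + (_ + _)))))).
1-4: by apply: eq_bigr => -[[i p] q] _.
all: by apply: eq_bigr => -[i p] _.
Qed.

Lemma state_normF_dec x : state_normF (dec x) = Num.sqrt (sqnormF x).
Proof.
rewrite sqnormFE; have := fdot_enc (dec x) (dec x); rewrite decK => ->.
congr Num.sqrt.
by apply: eq_bigr => i _; rewrite !sqnormFE.
Qed.

Lemma normF_Pv_le Q i : normF (Pv Q i) <= state_normF Q.
Proof.
apply: ler_wsqrtr; rewrite (bigD1 i)//= -!addrA lerDl.
by rewrite ?addr_ge0 ?sqnormF_ge0// sumr_ge0// => j _; rewrite !addr_ge0 ?sqnormF_ge0.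
Qed.

(** Orthogonal projection onto the states with all [P_i 1 = 0]. Composing the field with it yields a
    matrix that is dissipative on the whole coordinate space. *)
Definition projS Q : state R n :=
  State (fun i => projD (Pv Q i)) (Kv Q) (Thetav Q) (Upsilonv Q) (yv Q) (zv Q)
        (lambdav Q).

Definition lin {m k} (f : state R n -> 'M[R]_(m, k)) : Prop :=
  forall c Q Q', f (comb c Q Q') = c *: f Q + f Q'.

Lemma linD m k (f g : state R n -> 'M[R]_(m, k)) :
  lin f -> lin g -> lin (fun Q => f Q + g Q).
Proof. by move=> hf hg c Q Q'; rewrite hf hg scalerDr addrACA. Qed.

Lemma linZ m k (a : R) (f : state R n -> 'M[R]_(m, k)) :
  lin f -> lin (fun Q => a *: f Q).
Proof. by move=> hf c Q Q'; rewrite hf scalerDr !scalerA mulrC. Qed.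

Lemma linN m k (f : state R n -> 'M[R]_(m, k)) : lin f -> lin (fun Q => - f Q).
Proof. by move=> hf c Q Q'; rewrite hf opprD scalerN. Qed.

Lemma lin_mulr m k l (A : 'M[R]_(k, l)) (f : state R n -> 'M[R]_(m, k)) :
  lin f -> lin (fun Q => f Q *m A).
Proof. by move=> hf c Q Q'; rewrite hf mulmxDl scalemxAl. Qed.

Lemma lin_mull m k l (A : 'M[R]_(m, k)) (f : state R n -> 'M[R]_(k, l)) :
  lin f -> lin (fun Q => A *m f Q).
Proof. by move=> hf c Q Q'; rewrite hf mulmxDr scalemxAr. Qed.

Lemma lin_map m k m' k' (L : {linear 'M[R]_(m, k) -> 'M[R]_(m', k')})
  (f : state R n -> 'M[R]_(m, k)) : lin f -> lin (fun Q => L (f Q)).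
Proof. by move=> hf c Q Q'; rewrite hf linearP. Qed.

Lemma lin_col_block i (f : state R n -> 'cV[R]_n) :
  lin f -> lin (fun Q => col_block i (f Q)).
Proof.
move=> hf c Q Q'; rewrite hf; apply/matrixP => p q; rewrite !mxE.
by case: eqP => //; rewrite mulr0 addr0.
Qed.

Lemma lin_row_block i (f : state R n -> 'rV[R]_n) :
  lin f -> lin (fun Q => row_block i (f Q)).
Proof.
move=> hf c Q Q'; rewrite hf; apply/matrixP => p q; rewrite !mxE.
by case: eqP => //; rewrite mulr0 addr0.
Qed.

Lemma lin_coupling w i (F : state R n -> 'I_n -> 'M[R]_n) :
  (forall j, lin (F^~ j)) -> lin (fun Q => coupling w (F Q) i).
Proof.
move=> hF c Q Q'; rewrite /coupling scaler_sumr -big_split/=.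
by apply: eq_bigr => j _; apply: (linZ _ (linD (hF i) (linN (hF j)))).
Qed.

Lemma projS_comb c Q Q' : projS (comb c Q Q') = comb c (projS Q) (projS Q').
Proof.
congr State; apply/funext => i.
exact: (@lin_mulr _ _ _ _ (fun Q => Pv Q i)).
Qed.

Lemma vfield_comb (A B w : 'M[R]_n) c Q Q' :
  vfield A B w (comb c Q Q') = comb c (vfield A B w Q) (vfield A B w Q').
Proof.
(* [vfield] destructures its argument, so it reduces only on an explicit [State]. *)
have vE Q1 : vfield A B w Q1 = vfield A B w (State (Pv Q1) (Kv Q1) (Thetav Q1)
    (Upsilonv Q1) (yv Q1) (zv Q1) (lambdav Q1)) by case: Q1.
rewrite (vE Q) (vE Q') /=.
have HP i : lin (fun Q => Pv Q i) by [].
have HK i : lin (fun Q => Kv Q i) by [].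
have HT i : lin (fun Q => Thetav Q i) by [].
have HU i : lin (fun Q => Upsilonv Q i) by [].
have Hy i : lin (fun Q => yv Q i) by [].
have Hz i : lin (fun Q => (zv Q i)^T).
  exact: (@lin_map _ _ _ _ trmx (fun Q => zv Q i)).
have Hl i : lin (fun Q => (lambdav Q i)^T).
  exact: (@lin_map _ _ _ _ trmx (fun Q => lambdav Q i)).
have Hr i : lin (fun Q => (col i B)^T *m Pv Q i - (zv Q i)^T).
  by apply: linD; [exact: lin_mull | exact: linN].
have He i : lin (fun Q => Pv Q i *m col i A - yv Q i).
  by apply: linD; [exact: lin_mulr | exact: linN].
congr State; apply/funext => i.
- apply: (@lin_mulr _ _ _ _ (fun Q => - ((Pv Q i *m col i A - yv Q i) *m (col i A)^T)
      - col i B *m (lambdav Q i)^T - coupling w (Thetav Q) i - coupling w (Pv Q) i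
      - col i B *m ((col i B)^T *m Pv Q i - (zv Q i)^T))).
  by do ![apply: linD | apply: linN]; do ?[exact: lin_mulr | exact: lin_mull
    | exact: (@lin_coupling w i (@Thetav R n)) | exact: (@lin_coupling w i (@Pv R n))].
- exact: (@lin_coupling w i (@Upsilonv R n)).
- exact: (@lin_coupling w i (@Pv R n)).
- have H : lin (fun Q => col_block i (yv Q i) - row_block i (zv Q i)^T
      - coupling w (Kv Q) i - coupling w (Upsilonv Q) i); last exact: H.
  do ![apply: linD | apply: linN].
  + exact: lin_col_block.
  + exact: lin_row_block.
  + exact: (@lin_coupling w i (@Kv R n)).
  + exact: (@lin_coupling w i (@Upsilonv R n)).
- have H : lin (fun Q => Pv Q i *m col i A - yv Q i - col i (Upsilonv Q i)); last exact: H.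
  apply: linD => //; apply: linN.
  exact: (@lin_map _ _ _ _ (col i) (fun Q => Upsilonv Q i)).
- have H : lin (fun Q => ((lambdav Q i)^T + row i (Upsilonv Q i) +
     ((col i B)^T *m Pv Q i - (zv Q i)^T))^T); last exact: H.
  apply: (@lin_map _ _ _ _ trmx); apply: linD => //; apply: linD => //.
  exact: (@lin_map _ _ _ _ (row i) (fun Q => Upsilonv Q i)).
- exact: (@lin_map _ _ _ _ trmx (fun Q => (col i B)^T *m Pv Q i - (zv Q i)^T)).
Qed.

End StateCoordinates.

(** * The coupling operator and the graph Laplacian *)

Section Coupling.
Context {R : realType} {n : nat}.
Variables (H : rel 'I_n) (w : 'M[R]_n).
Hypotheses (Hconn : connected_graph H) (hw : edge_weights H w).
Implicit Types X Y : 'I_n -> 'M[R]_n.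

Lemma weight_sym i j : w i j = w j i.
Proof. by rewrite -[in LHS]hw.1 mxE. Qed.

Lemma weight_ge0 i j : 0 <= w i j.
Proof. by have := hw.2 i j; case: (H i j) => [/ltW//|/eqP->]. Qed.

(** Dirichlet form of the weighted graph, obtained by adding the double sum to its copy with [i] and
    [j] exchanged. *)
Lemma coupling_fdot X Y : 2 * \sum_i fdot (X i) (coupling w Y i) =
  \sum_i \sum_j w i j * fdot (X i - X j) (Y i - Y j).
Proof.
have E : \sum_i fdot (X i) (coupling w Y i) =
    \sum_i \sum_j w i j * fdot (X i) (Y i - Y j).
  apply: eq_bigr => i _; rewrite fdot_sumr.
  by apply: eq_bigr => j _; rewrite fdotZr.
rewrite mulr2n mulrDl mul1r {1}E [in X in _ + X]E [X in _ + X]exchange_big.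
rewrite -big_split; apply: eq_bigr => i _; rewrite -big_split.
by apply: eq_bigr => j _; rewrite /= (weight_sym j i) !fdotlin; ring.
Qed.

Lemma coupling_sym X Y :
  \sum_i fdot (X i) (coupling w Y i) = \sum_i fdot (Y i) (coupling w X i).
Proof.
apply: (@mulfI _ (2 : R)) => //; rewrite !coupling_fdot.
by do 2 (apply: eq_bigr => ? _); rewrite fdotC.
Qed.

Lemma coupling_ge0 X : 0 <= \sum_i fdot (X i) (coupling w X i).
Proof.
rewrite -(pmulr_rge0 _ (ltr0Sn R 1)) coupling_fdot.
do 2 (apply: sumr_ge0 => ? _).
by rewrite mulr_ge0 ?weight_ge0// -sqnormFE sqnormF_ge0.
Qed.

(** Zero energy forces equality across each edge; paths propagate it. *)
Lemma coupling_eq0 X : \sum_i fdot (X i) (coupling w X i) = 0 ->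
  forall i j, X i = X j.
Proof.
move=> X0; have edge i j : H i j -> X i = X j.
  move=> ij; have := coupling_fdot X X; rewrite X0 mulr0 => /esym/eqP.
  have ge0 i' j' : 0 <= w i' j' * fdot (X i' - X j') (X i' - X j').
    by rewrite mulr_ge0 ?weight_ge0// -sqnormFE sqnormF_ge0.
  rewrite psumr_eq0 => [/allP/(_ i)|? _]; last by apply: sumr_ge0.
  rewrite mem_index_enum psumr_eq0 => [/(_ isT)/allP/(_ j)|? _]//.
  rewrite mem_index_enum => /(_ isT); have := hw.2 i j; rewrite ij => wp.
  rewrite mulf_eq0 gt_eqF//= -sqnormFE => /eqP/sqnormF_eq0/eqP.
  by rewrite subr_eq0 => /eqP.
move=> i j; have /connectP[p] := Hconn i j.
elim: p i => [i _ ->//|k p IH i /=/andP[/edge -> kp] jp].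
exact: IH.
Qed.

Lemma coupling_const X i : (forall i j, X i = X j) -> coupling w X i = 0.
Proof.
move=> Xc; apply: big1 => j _.
by rewrite (Xc i j) subrr scaler0.
Qed.

Lemma sum_coupling X : \sum_i coupling w X i = 0.
Proof.
have E : \sum_i \sum_j w i j *: (X i - X j) = - \sum_i \sum_j w i j *: (X i - X j).
  rewrite -sumrN [LHS]exchange_big; apply: eq_bigr => i _; rewrite -sumrN.
  by apply: eq_bigr => j _; rewrite (weight_sym j i) -scalerN opprB.
apply/matrixP => p q; move/matrixP/(_ p q): E; rewrite !mxE; lra.
Qed.

Definition laplacian : 'M[R]_n :=
  \matrix_(i, j) ((if i == j then \sum_k w i k else 0) - w i j).

Lemma laplacian_sym : laplacian^T = laplacian.
Proof.
apply/matrixP => i j; rewrite !mxE (weight_sym j i) eq_sym.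
by case: eqP => [->|].
Qed.

Lemma mulmx_laplacian m (v : 'M[R]_(n, m)) i q :
  (laplacian *m v) i q = \sum_j w i j * (v i q - v j q).
Proof.
rewrite mxE (eq_bigr (fun j => (if i == j then \sum_k w i k else 0) * v j q - w i j * v j q));
  last by move=> j _; rewrite mxE mulrBl.
rewrite sumrB (bigD1 i)//= eqxx [X in _ + X - _]big1 => [|j ji]; last first.
  by rewrite eq_sym (negbTE ji) mul0r.
by rewrite addr0 mulr_suml -sumrB; apply: eq_bigr => j _; ring.
Qed.

Lemma ker_laplacian (v : 'cV[R]_n) : laplacian *m v = 0 -> forall i j, v i 0 = v j 0.
Proof.
(* Scalar matrices carry the vector [v] over to [coupling_eq0]. *)
move=> Lv i j; pose X k : 'M[R]_n := (v k 0)%:M.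
have XL k : coupling w X k = 0.
  transitivity (((laplacian *m v) k 0)%:M : 'M[R]_n); last by rewrite Lv mxE raddf0.
  rewrite mulmx_laplacian raddf_sum; apply: eq_bigr => l _.
  by rewrite /X -raddfB scale_scalar_mx.
have /coupling_eq0/(_ i j)/matrixP/(_ i i) : \sum_k fdot (X k) (coupling w X k) = 0.
  by apply: big1 => k _; rewrite XL fdotC fdot0l.
by rewrite !mxE eqxx.
Qed.

(** Entry by entry this is a Laplacian system; the Laplacian is symmetric with only constants in its
    kernel, so its range consists of the vectors of zero sum. *)
Lemma coupling_surj X : \sum_i X i = 0 -> exists Y, forall i, coupling w Y i = X i.
Proof.
move=> X0; pose g p q : 'rV[R]_n := \row_i X i p q.
have gL p q : (g p q <= laplacian)%MS.
  rewrite submxE; apply/eqP/rowP => k; rewrite !mxE.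
  have /ker_laplacian c : laplacian *m col k (cokermx laplacian) = 0.
    by rewrite colE mulmxA mulmx_coker mul0mx.
  (* The columns of the cokernel are constant, so the entry at [j] may be replaced by the one at [p]
     and factored out of the sum. *)
  transitivity (\sum_j X j p q * cokermx laplacian p k).
    apply: eq_bigr => j _; rewrite mxE; congr (_ * _).
    by have := c j p; rewrite !mxE.
  rewrite -mulr_suml; move/matrixP/(_ p q): X0; rewrite summxE mxE => ->.
  by rewrite mul0r.
exists (fun i => \matrix_(p, q) (g p q *m pinvmx laplacian) 0 i) => i.
apply/matrixP => p q; rewrite /coupling summxE.
have := congr1 (fun v : 'rV[R]_n => v^T i 0) (mulmxKpV (gL p q)).
rewrite trmx_mul laplacian_sym mulmx_laplacian => E.
transitivity ((g p q)^T i 0); last by rewrite !mxE.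
by rewrite -E; apply: eq_bigr => j _; rewrite !mxE.
Qed.

End Coupling.

(** * The projection onto matrices that annihilate the all-ones vector *)

Section Projection.
Context {R : realType} {n : nat}.
Implicit Types V X : 'M[R]_n.

Lemma mul_projD_ones V : projD V *m (ones : 'cV[R]_n) = 0.
Proof.
rewrite /projD -mulmxA mulmxBl mul1mx -scalemxAl -mulmxA.
(* For [n = 0] the inverse [n%:R^-1] is the default 0, but there are no entries to compare. *)
have [n0|n0] := eqVneq n 0%N.
  by apply/matrixP => p q; have := ltn_ord p; rewrite [X in (_ < X)%N]n0.
have -> : ones^T *m (ones : 'cV[R]_n) = (n%:R)%:M.
  apply/matrixP => p q; rewrite !mxE !ord1 eqxx (eq_bigr (fun=> 1)) => [|k _].
    by rewrite sumr_const card_ord.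
  by rewrite !mxE mulr1.
by rewrite mul_mx_scalar scalerA mulVf ?pnatr_eq0// scale1r subrr mulmx0.
Qed.

Lemma projD_id V : V *m (ones : 'cV[R]_n) = 0 -> projD V = V.
Proof.
by move=> V0; rewrite /projD mulmxBr mulmx1 -scalemxAr mulmxA V0 mul0mx scaler0 subr0.
Qed.

Lemma projD_idem V : projD (projD V) = projD V.
Proof. exact: projD_id (mul_projD_ones V). Qed.

Lemma fdot_projD V X : fdot (projD V) X = fdot V (projD X).
Proof.
rewrite /projD fdot_mulr; congr (fdot _ (_ *m _)).
by rewrite linearB/= linearZ/= trmx_mul trmxK trmx1.
Qed.

Lemma projD0 : projD (0 : 'M[R]_n) = 0.
Proof. by rewrite /projD mul0mx. Qed.

End Projection.

(** * Single-column and single-row matrices *)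

Section Blocks.
Context {R : realType} {n : nat}.
Implicit Types (i : 'I_n) (X : 'M[R]_n).

(** Adjointness with column extraction; with its row analogue, it cancels the Upsilon terms against
    those of y and z in the energy balance. *)
Lemma fdot_col_block i X (v : 'cV[R]_n) : fdot X (col_block i v) = fdot (col i X) v.
Proof.
rewrite !fdotE; apply: eq_bigr => p _; rewrite big_ord1 (bigD1 i)//= big1 => [|q qi].
  by rewrite !mxE eqxx addr0.
by rewrite !mxE (negbTE qi) mulr0.
Qed.

Lemma fdot_row_block i X (v : 'rV[R]_n) : fdot X (row_block i v) = fdot (row i X) v.
Proof.
rewrite !fdotE big_ord1 (bigD1 i)//= [X in _ + X]big1 => [|p pi].
  by rewrite addr0; apply: eq_bigr => q _; rewrite !mxE eqxx.
by apply: big1 => q _; rewrite !mxE (negbTE pi) mulr0.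
Qed.

Lemma sum_col_block X : \sum_i col_block i (col i X) = X.
Proof.
apply/matrixP => p q; rewrite summxE (bigD1 q)//= big1 => [|i iq].
  by rewrite !mxE eqxx addr0.
by rewrite !mxE eq_sym (negbTE iq).
Qed.

Lemma sum_row_block X : \sum_i row_block i (row i X) = X.
Proof.
apply/matrixP => p q; rewrite summxE (bigD1 p)//= big1 => [|i iq].
  by rewrite !mxE eqxx addr0.
by rewrite !mxE eq_sym (negbTE iq).
Qed.

End Blocks.

(** * Permutation matrices *)

Section PermutationMatrix.
Context {R : realType} {n : nat}.

Lemma perm_mx_mul_tr (Pi : 'M[R]_n) : is_perm_mx Pi -> Pi *m Pi^T = 1%:M.
Proof.
move=> /is_perm_mxP[s ->]; rewrite -row_permE; apply/matrixP => i j.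
by rewrite !mxE (inj_eq perm.perm_inj) eq_sym.
Qed.

Lemma perm_mx_ones (Pi : 'M[R]_n) : is_perm_mx Pi -> Pi *m ones = ones.
Proof.
by move=> /is_perm_mxP[s ->]; rewrite -row_permE; apply/matrixP => i j; rewrite !mxE.
Qed.

Lemma perm_relates_comm (Pi A B : 'M[R]_n) :
  perm_relates Pi A B -> Pi *m A = B *m Pi.
Proof. by move=> [Pp ->]; rewrite !mulmxA perm_mx_mul_tr// mul1mx. Qed.

End PermutationMatrix.

(** * Rigidity of intertwiners for friendly graphs *)

Section Friendly.
Context {R : realType} {n : nat}.
Variables (A : 'M[R]_n).
Hypotheses (Asym : A^T = A) (Afri : friendly A).

(* For an eigenvector [v], [v C] lies in the same eigenspace and is orthogonal
   to [ones], hence vanishes. *)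
Lemma friendly_commute (C : 'M[R]_n) :
  A *m C = C *m A -> C *m (ones : 'cV[R]_n) = 0 -> C = 0.
Proof.
move=> AC C0; have [[s [us ss /allP sA]] fri] := Afri.
have rows a : (eigenspace A a <= kermx C)%MS.
  apply/row_subP => i; set v := row i _.
  have /eigenspaceP vA : (v <= eigenspace A a)%MS by exact: row_sub.
  apply/sub_kermxP/eqP/negPn/negP => vC.
  have : is_eigenvector A (v *m C)^T.
    split; first by rewrite trmx_eq0.
    exists a; rewrite -{1}Asym -trmx_mul -mulmxA -AC mulmxA vA -scalemxAl.
    by rewrite linearZ.
  by move/fri/eqP; apply; rewrite -trmx_mul -mulmxA C0 mulmx0 trmx0.
have dir : mxdirect (\sum_(i < size s) eigenspace A s`_i).
  apply: mxdirect_sum_eigenspace => i j _ _ sij; apply/val_inj.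
  by apply: uniqP sij => //; rewrite ?inE.
(* The sum of the [n] eigenspaces is direct and each has rank at least 1, so it fills the space. *)
have full : (1%:M <= \sum_(i < size s) eigenspace A s`_i)%MS.
  rewrite sub1mx -col_leq_rank (mxdirectP dir)/= -[X in (X <= _)%N]ss.
  rewrite -[X in (X <= _)%N]card_ord -sum1_card; apply: leq_sum => i _.
  by rewrite lt0n mxrank_eq0; apply: sA; exact: mem_nth.
have /(submx_trans full)/sub_kermxP : (\sum_(i < size s) eigenspace A s`_i <= kermx C)%MS.
  by apply/sumsmx_subP => i _; exact: rows.
by rewrite mul1mx.
Qed.

Lemma friendly_intertwiner (B Pi P : 'M[R]_n) : perm_relates Pi A B ->
  P *m A = B *m P -> P *m (ones : 'cV[R]_n) = 0 -> P = 0.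
Proof.
move=> [/perm_mx_mul_tr PiK AE] PA P0.
have C0 : Pi^T *m P = 0.
  apply: friendly_commute; last by rewrite -mulmxA P0 mulmx0.
  by rewrite -[RHS]mulmxA PA {1}AE -!mulmxA (mulmxA Pi) PiK mul1mx.
by rewrite -[P]mul1mx -PiK -mulmxA C0 mulmx0.
Qed.

End Friendly.

(** * Energy balance, equilibria and observability of the system *)

Section Dynamics.
Context {R : realType} {n : nat}.
Variables (A B w : 'M[R]_n) (H : rel 'I_n).
Hypotheses (Hconn : connected_graph H) (hw : edge_weights H w).
Implicit Types Q : state R n.

Local Notation F := (vfield A B w).

Definition yres Q i : 'cV[R]_n := Pv Q i *m col i A - yv Q i.
Definition zres Q i : 'rV[R]_n := (col i B)^T *m Pv Q i - (zv Q i)^T.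

Lemma Pv_vfield Q i : Pv (F Q) i = projD (- (yres Q i *m (col i A)^T)
  - col i B *m (lambdav Q i)^T - coupling w (Thetav Q) i
  - coupling w (Pv Q) i - col i B *m zres Q i).
Proof. by case: Q. Qed.

Lemma Kv_vfield Q i : Kv (F Q) i = coupling w (Upsilonv Q) i.
Proof. by case: Q. Qed.

Lemma Thetav_vfield Q i : Thetav (F Q) i = coupling w (Pv Q) i.
Proof. by case: Q. Qed.

Lemma Upsilonv_vfield Q i : Upsilonv (F Q) i = col_block i (yv Q i)
  - row_block i (zv Q i)^T - coupling w (Kv Q) i - coupling w (Upsilonv Q) i.
Proof. by case: Q. Qed.

Lemma yv_vfield Q i : yv (F Q) i = yres Q i - col i (Upsilonv Q i).
Proof. by case: Q. Qed.

Lemma zv_vfield Q i :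
  zv (F Q) i = ((lambdav Q i)^T + row i (Upsilonv Q i) + zres Q i)^T.
Proof. by case: Q. Qed.

Lemma lambdav_vfield Q i : lambdav (F Q) i = (zres Q i)^T.
Proof. by case: Q. Qed.

Definition vfieldE := (Pv_vfield, Kv_vfield, Thetav_vfield, Upsilonv_vfield,
  yv_vfield, zv_vfield, lambdav_vfield).

(** The projection is self-adjoint and fixes [P_i], so it drops out. The lambda terms cancel among
    P, z and lambda, and the Upsilon terms against y and z. *)
Lemma energy_identity Q : (forall i, projD (Pv Q i) = Pv Q i) ->
  sdot Q (F Q) = - (\sum_i (sqnormF (yres Q i) + sqnormF (zres Q i))
    + \sum_i fdot (Pv Q i) (coupling w (Pv Q) i)
    + \sum_i fdot (Upsilonv Q i) (coupling w (Upsilonv Q) i)).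
Proof.
move=> PQ.
(* The balance of a single agent; its last two brackets cancel only after summation over the agents,
   by [coupling_sym]. *)
have E i : fdot (Pv Q i) (Pv (F Q) i) + fdot (Kv Q i) (Kv (F Q) i) +
    fdot (Thetav Q i) (Thetav (F Q) i) + fdot (Upsilonv Q i) (Upsilonv (F Q) i) +
    fdot (yv Q i) (yv (F Q) i) + fdot (zv Q i) (zv (F Q) i) +
    fdot (lambdav Q i) (lambdav (F Q) i) =
    - (sqnormF (yres Q i) + sqnormF (zres Q i))
    - fdot (Pv Q i) (coupling w (Pv Q) i)
    - fdot (Upsilonv Q i) (coupling w (Upsilonv Q) i)
    + (fdot (Thetav Q i) (coupling w (Pv Q) i)
       - fdot (Pv Q i) (coupling w (Thetav Q) i))
    + (fdot (Kv Q i) (coupling w (Upsilonv Q) i)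
       - fdot (Upsilonv Q i) (coupling w (Kv Q) i)).
  have ea : fdot (Pv Q i) (yres Q i *m (col i A)^T) = fdot (Pv Q i *m col i A) (yres Q i).
    by rewrite [in RHS]fdot_mulr.
  have eb (X : 'rV[R]_n) : fdot (Pv Q i) (col i B *m X) = fdot ((col i B)^T *m Pv Q i) X.
    by rewrite fdot_mull trmxK.
  have ey : Pv Q i *m col i A = yres Q i + yv Q i by rewrite subrK.
  have ez : (col i B)^T *m Pv Q i = zres Q i + (zv Q i)^T by rewrite subrK.
  rewrite Pv_vfield -fdot_projD PQ !vfieldE -(fdot_tr (zv Q i)) -(fdot_tr (lambdav Q i)).
  rewrite !trmxK; move: (yres Q i) (zres Q i) ey ez ea => e r ey ez ea.
  rewrite !fdotlin ea !eb fdot_col_block fdot_row_block ey ez !sqnormFE !fdotlin.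
  rewrite (fdotC (lambdav Q i)^T r) (fdotC (col i _)) (fdotC (row i _)); ring.
rewrite /sdot (eq_bigr _ (fun i _ => E i)) !big_split/= !sumrN !big_split/=.
rewrite (coupling_sym hw (Thetav Q)) (coupling_sym hw (Kv Q)); ring.
Qed.

(* The points of zero dissipation. *)
Definition quiet Q : Prop :=
  [/\ forall i, yres Q i = 0, forall i, zres Q i = 0,
      forall i j, Pv Q i = Pv Q j & forall i j, Upsilonv Q i = Upsilonv Q j].

Lemma sdot_vfield_le0 Q : (forall i, projD (Pv Q i) = Pv Q i) ->
  sdot Q (F Q) <= 0.
Proof.
move=> /energy_identity->; rewrite oppr_le0 !addr_ge0 ?(coupling_ge0 hw)//.
by apply: sumr_ge0 => i _; rewrite addr_ge0// sqnormF_ge0.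
Qed.

Lemma sdot_vfield_eq0 Q : (forall i, projD (Pv Q i) = Pv Q i) ->
  sdot Q (F Q) = 0 -> quiet Q.
Proof.
move=> /energy_identity-> /eqP; rewrite oppr_eq0.
have rge0 i : 0 <= sqnormF (yres Q i) + sqnormF (zres Q i).
  by rewrite addr_ge0// sqnormF_ge0.
rewrite !paddr_eq0 ?addr_ge0 ?(coupling_ge0 hw)// ?sumr_ge0//.
move=> /andP[/andP[]]; rewrite psumr_eq0// => /allP r0.
have {}r0 i : (yres Q i = 0) * (zres Q i = 0).
  have := r0 i (mem_index_enum i); rewrite paddr_eq0 ?sqnormF_ge0//.
  by move=> /andP[/eqP/sqnormF_eq0-> /eqP/sqnormF_eq0->].
move=> /eqP/(coupling_eq0 Hconn hw) Pc /eqP/(coupling_eq0 Hconn hw) Uc.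
by split=> // i; rewrite r0.
Qed.

Lemma mx_col0 (X : 'M[R]_n) : (forall i, col i X = 0) -> X = 0.
Proof.
move=> X0; apply/matrixP => p q.
by move/colP/(_ p): (X0 q); rewrite !mxE.
Qed.

(* [quiet Q] makes lambda, Theta and K of [F Q] vanish; then [quiet (F Q)] makes
   P of [F (F Q)] vanish, hence y and z too; the same one step later gives
   y = 0 there, and the equation for y kills Upsilon of [F (F Q)]. *)
Lemma quiet_orbit Q : quiet Q -> quiet (F Q) -> quiet (F (F Q)) ->
  quiet (F (F (F Q))) -> F (F Q) = zero_state.
Proof.
move=> q0 q1 q2 q3.
have still Q' i : quiet Q' ->
    [/\ lambdav (F Q') i = 0, Thetav (F Q') i = 0 & Kv (F Q') i = 0].
  by case=> y0 z0 Pc Uc; rewrite !vfieldE z0 trmx0 !coupling_const.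
have P0 Q' i : quiet Q' -> quiet (F Q') -> Pv (F (F Q')) i = 0.
  move=> q' [y0 z0 Pc Uc]; have [l0 _ _] := still Q' i q'.
  rewrite Pv_vfield y0 z0 l0 trmx0 !coupling_const// ?(mul0mx, mulmx0, subr0, oppr0).
    exact: projD0.
  by move=> j k; have [_ -> _] := still Q' j q'; have [_ -> _] := still Q' k q'.
have y0 Q' i : quiet Q' -> Pv Q' i = 0 -> yv Q' i = 0.
  by move=> [/(_ i) + _ _ _] P'; rewrite /yres P' mul0mx sub0r => /eqP; rewrite oppr_eq0 => /eqP.
have z0 Q' i : quiet Q' -> Pv Q' i = 0 -> zv Q' i = 0.
  move=> [_ /(_ i) + _ _] P'; rewrite /zres P' mulmx0 sub0r => /eqP.
  by rewrite oppr_eq0 trmx_eq0 => /eqP.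
have U0 Q' i : quiet Q' -> (forall j, yv (F Q') j = 0) -> Upsilonv Q' i = 0.
  move=> [r0 _ _ Uc] yF; apply: mx_col0 => j; apply/eqP.
  by rewrite -oppr_eq0 (Uc i j); have := yF j; rewrite yv_vfield r0 sub0r => ->.
have P2 i : Pv (F (F Q)) i = 0 by exact: P0.
have P3 i : Pv (F (F (F Q))) i = 0 by exact: P0.
have U2 i : Upsilonv (F (F Q)) i = 0 by apply: U0 => // j; exact: y0.
have y2 i := y0 _ i q2 (P2 i); have z2 i := z0 _ i q2 (P2 i).
by apply: state_eq0 => // i; have [] := still _ i q1.
Qed.

(** Summing the Upsilon equation over the agents removes the couplings and equates the matrix with
    columns [y_j] to the one with rows [z_j^T]. With zero residuals and a common P these are
    [P *m A] and [B *m P]. *)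
Lemma quiet_equilibrium_intertwines Q i : B^T = B -> quiet Q ->
  F Q = zero_state -> Pv Q i *m A = B *m Pv Q i.
Proof.
move=> Bsym [y0 z0 Pc Uc] FQ.
have : \sum_j Upsilonv (F Q) j = 0 by rewrite FQ big1.
under eq_bigr do rewrite Upsilonv_vfield.
rewrite !sumrB !(sum_coupling hw) !subr0 => /eqP; rewrite subr_eq0 => /eqP.
rewrite (eq_bigr (fun j => col_block j (col j (Pv Q i *m A)))) => [|j _]; last first.
  rewrite (Pc i j); congr col_block.
  by rewrite colE -mulmxA -colE; apply/eqP; rewrite eq_sym -subr_eq0 -/(yres Q j) y0.
rewrite sum_col_block => ->.
rewrite (eq_bigr (fun j => row_block j (row j (B *m Pv Q i)))) => [|j _].
  exact: sum_row_block.
rewrite (Pc i j); congr row_block; rewrite row_mul -[in RHS]Bsym -tr_col.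
by apply/eqP; rewrite eq_sym -subr_eq0 -/(zres Q j) z0.
Qed.

Lemma equilibrium_exists Pi : B^T = B -> Pi *m A = B *m Pi ->
  exists2 Q, F Q = zero_state & forall i, Pv Q i = Pi.
Proof.
move=> Bsym PiA.
have [K KE] : exists K, forall i, coupling w K i =
    col_block i (Pi *m col i A) - row_block i ((col i B)^T *m Pi).
  apply: (coupling_surj Hconn hw); rewrite sumrB.
  have -> : \sum_i col_block i (Pi *m col i A) = Pi *m A.
    by rewrite -[RHS]sum_col_block; apply: eq_bigr => i _; rewrite !colE mulmxA.
  have -> : \sum_i row_block i ((col i B)^T *m Pi) = B *m Pi.
    rewrite -[RHS]sum_row_block; apply: eq_bigr => i _.
    by rewrite row_mul tr_col Bsym.
  by rewrite PiA subrr.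
(* Consensus at [Pi], with y and z chosen to make the residuals vanish; [K] balances the Upsilon
   equation. *)
pose Q := State (fun=> Pi) K (fun=> 0) (fun=> 0) (fun i => Pi *m col i A)
  (fun i => ((col i B)^T *m Pi)^T) (fun=> 0).
have y0 i : yres Q i = 0 by rewrite /yres subrr.
have z0 i : zres Q i = 0 by rewrite /zres /= trmxK subrr.
exists Q => //; apply: state_eq0 => i; rewrite vfieldE ?y0 ?z0.
- by rewrite trmx0 !coupling_const// !(mul0mx, mulmx0, subr0, oppr0) projD0.
- by rewrite coupling_const.
- by rewrite coupling_const.
- by rewrite /= KE (@coupling_const _ _ _ (fun=> 0))// trmxK subrr subr0.
- by rewrite /= raddf0 subr0.
- by rewrite /= trmx0 raddf0 !addr0 trmx0.
- by rewrite trmx0.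
Qed.

Lemma linear_rowmx N (f : 'rV[R]_N -> 'rV[R]_N) :
  (forall c x y, f (c *: x + y) = c *: f x + f y) ->
  exists M : 'M[R]_N, forall x, x *m M = f x.
Proof.
move=> flin; pose fl := GRing.isLinear.Build R 'rV[R]_N 'rV[R]_N *:%R f flin.
pose f' : {linear 'rV[R]_N -> 'rV[R]_N} := HB.pack f fl.
by exists (lin1_mx f') => x; rewrite mul_rV_lin1.
Qed.

Lemma vfield_mx : exists M : 'M[R]_#|@idx n|,
  forall x, x *m M = enc (F (projS (dec x))).
Proof.
apply: linear_rowmx => c x y.
by rewrite dec_comb projS_comb vfield_comb enc_comb.
Qed.

Lemma projS_vfield Q : projS (F Q) = F Q.
Proof.
rewrite [in RHS](_ : F Q = State (Pv (F Q)) (Kv (F Q)) (Thetav (F Q))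
  (Upsilonv (F Q)) (yv (F Q)) (zv (F Q)) (lambdav (F Q))); last by case: Q.
by congr State; apply/funext => i; rewrite Pv_vfield projD_idem.
Qed.

Lemma sdot_projS Q Q' : sdot Q (projS Q') = sdot (projS Q) Q'.
Proof. by apply: eq_bigr => i _; rewrite /= fdot_projD. Qed.

Lemma projS_id Q : (forall i, Pv Q i *m (ones : 'cV[R]_n) = 0) -> projS Q = Q.
Proof.
case: Q => P K T U y z l /= P0; congr State.
by apply/funext => i; exact: projD_id.
Qed.

Section Matrix.
Variable M : 'M[R]_#|@idx n|.
Hypothesis ME : forall x, x *m M = enc (F (projS (dec x))).

Lemma dec_mulmx x : dec (x *m M) = F (projS (dec x)).
Proof. by rewrite ME encK. Qed.

Lemma projD_projS Q i : projD (Pv (projS Q) i) = Pv (projS Q) i.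
Proof. exact: projD_idem. Qed.

(** The field takes values in the range of [projS], so the self-adjoint projection may be inserted
    in the left factor. *)
Lemma fdot_vfield_mx x :
  fdot x (x *m M) = sdot (projS (dec x)) (F (projS (dec x))).
Proof. by rewrite -{1}(decK x) ME fdot_enc -sdot_projS projS_vfield. Qed.

Lemma vfield_mx_dissipative (x : 'rV[R]_#|@idx n|) : fdot x (x *m M) <= 0.
Proof. by rewrite fdot_vfield_mx sdot_vfield_le0// => i; exact: projD_projS. Qed.

Lemma dissipation_quiet (x : 'rV[R]_#|@idx n|) : dissipation M x = 0 -> quiet (projS (dec x)).
Proof.
move=> /eqP; rewrite oppr_eq0 fdot_vfield_mx => /eqP; apply: sdot_vfield_eq0 => i.
exact: projD_projS.
Qed.

(** Levels 0 to 3 supply the four quiet states of [quiet_orbit], which gives [x *m M *m M = 0];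
    [dissipative_ker_sqr] removes one factor. *)
Lemma vfield_mx_observable (x : 'rV[R]_#|@idx n|) :
  (forall k, (k <= 3)%N -> dissipation M (x *m mxpow M k) = 0) -> x *m M = 0.
Proof.
move=> d0; apply: (dissipative_ker_sqr vfield_mx_dissipative).
have q (k : nat) : (k <= 3)%N -> quiet (projS (dec (x *m mxpow M k))).
  by move=> /d0/dissipation_quiet.
have S k : projS (dec (x *m mxpow M k.+1)) = F (projS (dec (x *m mxpow M k))).
  by rewrite mulmx_mxpowS dec_mulmx projS_vfield.
have q0 := q 0%N isT; have q1 := q 1%N isT; have q2 := q 2%N isT; have q3 := q 3%N isT.
have E0 : x *m mxpow M 0 = x by exact: mulmx_mxpow0.
rewrite !S E0 in q0 q1 q2 q3.
rewrite -(decK (x *m M *m M)) !dec_mulmx projS_vfield (quiet_orbit q0 q1 q2 q3).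
by apply/rowP => k; rewrite !mxE entry_zero.
Qed.

End Matrix.

End Dynamics.

(** * Trajectories: coordinates and the invariant row-sum constraint *)

Section Trajectories.
Context {R : realType} {n : nat}.
Variables (A B w : 'M[R]_n).
Local Notation F := (vfield A B w).
Implicit Types Q : R -> state R n.

Lemma has_velocity_entry m k (X V : R -> 'M[R]_(m, k)) i j :
  has_velocity X V -> has_rate (fun t => X t i j) (fun t => V t i j).
Proof.
move=> [cX dX]; split=> [x|t t0].
  exact: (@continuous_comp (subspace _) _ _ X (fun M : 'M[R]_(m, k) => M i j) x
    (cX x) (@coord_continuous _ _ _ i j _)).
have [der eq] := dX t t0; apply: DeriveDef; first by move/derivable_mxP: der.
by rewrite -eq derive_mx// mxE.
Qed.

Lemma trajectory_entry Q (s : @idx n) : is_trajectory A B w Q ->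
  has_rate (fun t => entry (Q t) s) (fun t => entry (F (Q t)) s).
Proof.
move=> trQ.
case: s => [[[i p] q]|[[[i p] q]|[[[i p] q]|[[[i p] q]|[[i p]|[[i p]|[i p]]]]]]];
  have [? [? [? [? [? [? ?]]]]]] := trQ i; exact: has_velocity_entry.
Qed.

Lemma trajectory_inD Q i : is_trajectory A B w Q -> inD (Pv (Q 0) i) ->
  forall t, 0 <= t -> inD (Pv (Q t) i).
Proof.
move=> trQ D0 t t0; apply/colP => p; rewrite -[in RHS]D0.
have rate : has_rate (fun t => (Pv (Q t) i *m ones) p 0) (fun=> 0).
  have [vP _] := trQ i.
  have H := has_rate_sum (index_enum 'I_n) (fun q => has_velocity_entry p q vP).
  apply: has_rate_eq H => [s|s _].
    by rewrite mxE; apply: eq_bigr => q _; rewrite [X in _ * X]mxE mulr1.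
  transitivity ((Pv (F (Q s)) i *m ones) p 0).
    by rewrite mxE; apply: eq_bigr => q _; rewrite [X in _ * X]mxE mulr1.
  by rewrite Pv_vfield mul_projD_ones mxE.
(* Monotonicity of the function and of its opposite gives constancy. *)
have := has_rate_nonincreasing rate (fun _ _ => lexx 0) t0.
have := has_rate_nonincreasing (has_rateZ (-1) rate) _ t0.
rewrite !mulN1r lerN2 => up down; apply/eqP; rewrite eq_le down up//.
Qed.

End Trajectories.

(** * Exponential convergence of the distributed system *)

Theorem theorem3 (R : realType) (n : nat) (A B Pi : 'M[R]_n)
    (H : rel 'I_n) (w : 'M[R]_n)
    (hA : is_adjacency A) (hB : is_adjacency B)
    (hiso : isomorphic A B)
    (hasymA : asymmetric A) (hasymB : asymmetric B)
    (hfriA : friendly A) (hfriB : friendly B)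
    (hPi : perm_relates Pi A B)
    (hHsym : symmetric H) (hHconn : connected_graph H)
    (hw : edge_weights H w) :
  exists c alpha : R, 0 < c /\ 0 < alpha /\
    forall Q : R -> state R n,
      is_trajectory A B w Q ->
      (forall i, inD (Pv (Q 0) i)) ->
      (exists Qbar : state R n,
         is_equilibrium A B w Qbar /\
         forall t : R, 0 <= t ->
           state_normF (sub_state (Q t) Qbar)
           <= c * expR (- alpha * t) * state_normF (sub_state (Q 0) Qbar)) /\
      (forall i, cvg_exponentially (fun t => Pv (Q t) i) Pi).
Proof.
have [Qs Qs0 PvQs] := equilibrium_exists hHconn hw hB.1 (perm_relates_comm hPi).
have [M ME] := vfield_mx A B w.
have diss := vfield_mx_dissipative hw ME.
have [c [a [c0 [a0 cv]]]] :=
  dissipative_flow_cvg diss (vfield_mx_observable hHconn hw ME).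
exists c, a; split=> //; split=> // Q trQ D0.
(* The deviation from the reference equilibrium satisfies [P_i 1 = 0] for [0 <= t], so [projS] acts
   trivially on it and it follows the flow of [M]. *)
pose x t := enc (sub_state (Q t) Qs).
have inS t : 0 <= t -> projS (dec (x t)) = dec (x t).
  move=> t0; apply: projS_id => i; rewrite encK /= PvQs mulmxBl.
  by rewrite (trajectory_inD trQ (D0 i) t0) perm_mx_ones ?subrr//; case: hPi.
have flow : flow_of M x.
  move=> k; pose s := enum_val k.
  apply: has_rate_eq (has_rateD (trajectory_entry s trQ) (has_rate_cst (- entry Qs s))).
  - by move=> t; rewrite mxE entry_sub.
  - move=> t t0; rewrite ME inS ?ltW// encK mxE sub_stateE vfield_comb Qs0.
    by rewrite entry_comb entry_zero mulr0 add0r addr0.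
have [k [y [kM x0E xk]]] := cv x flow.
(* Both [x 0] and [y *m M] decode to states fixed by [projS], hence so does their difference [k]. *)
have kS : projS (dec k) = dec k.
  have -> : k = (-1) *: (y *m M) + x 0 by rewrite x0E scaleN1r addrC addrK.
  by rewrite dec_comb projS_comb inS// (dec_mulmx ME) projS_vfield.
have Fk : vfield A B w (dec k) = zero_state.
  rewrite -kS -(dec_mulmx ME) kM.
  by apply: state_ext => s; rewrite entry_dec entry_zero mxE.
(* The limit depends on the trajectory through [k], the kernel component of the initial
   deviation. *)
pose Qbar := comb 1 Qs (dec k).
have subE t : sub_state (Q t) Qbar = dec (x t - k).
  apply: state_ext => s; rewrite entry_dec entry_sub entry_comb !mxE mul1r.
  by rewrite enum_rankK entry_sub entry_dec opprD addrA.
have bound t : 0 <= t -> state_normF (sub_state (Q t) Qbar)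
    <= c * expR (- a * t) * state_normF (sub_state (Q 0) Qbar).
  by rewrite !subE !state_normF_dec; exact: xk.
split.
  exists Qbar; split=> //; rewrite /is_equilibrium vfield_comb Qs0 Fk.
  by apply: state_ext => s; rewrite entry_comb entry_zero mulr0 addr0.
have qk : quiet A B (dec k).
  rewrite -kS; apply: (dissipation_quiet hHconn hw ME).
  by rewrite /dissipation kM fdotC fdot0l oppr0.
have Pk i : Pv (dec k) i = 0.
  apply: (friendly_intertwiner hA.1 hfriA hPi).
    exact: (quiet_equilibrium_intertwines hw i hB.1 qk Fk).
  by rewrite -kS mul_projD_ones.
have Pbar i : Pv Qbar i = Pi.
  by rewrite -(PvQs i) -[LHS]/(1 *: Pv Qs i + Pv (dec k) i) Pk scale1r addr0.
move=> i; pose N0 := state_normF (sub_state (Q 0) Qbar).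
have N00 : 0 <= N0 by exact: sqrtr_ge0.
(* [N0] may vanish, so 1 is added to keep the constant positive. *)
exists (c * N0 + 1), a; split; first by rewrite ltr_wpDl// mulr_ge0// ltW.
split=> // t t0; rewrite -(Pbar i).
apply: le_trans (normF_Pv_le (sub_state (Q t) Qbar) i) _.
apply: le_trans (bound t t0) _; rewrite -/N0.
by have := expR_ge0 (- a * t); nra.
Qed.
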